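(* Let $(M,\varphi,\pi)$ be a Hom-Poisson manifold, where $\varphi:M\to M$ is a diffeomorphism. Then $(\varphi^!T^*M,\varphi,\mathrm{Ad}^\dagger_{\varphi^*},[\cdot,\cdot]_{\pi^\sharp},\pi^\sharp)$ is a Hom-Lie algebroid, where $\pi^\sharp:\varphi^!T^*M\to\varphi^!TM$ is the bundle map given by $\pi^\sharp(\xi)(\eta)=\pi(\xi,\eta)$, and $$[\xi,\eta]_{\pi^\sharp}=L_{\pi^\sharp(\xi)}\eta-L_{\pi^\sharp(\eta)}\xi-\mathrm{d}\,\pi(\xi,\eta),\qquad\forall\,\xi,\eta\in\Gamma(\varphi^!T^*M).$$
   Context: Manifolds, bundles and maps are smooth; functions are real-valued. A Hom-Lie algebra $(\mathfrak g,[\cdot,\cdot],\phi)$ is a vector space with a skew-symmetric bilinear bracket and a linear map $\phi$ such that $\phi[x,y]=[\phi(x),\phi(y)]$ and $[\phi(x),[y,z]]+[\phi(y),[z,x]]+[\phi(z),[x,y]]=0$. A representation of it on a vector space $V$ with respect to $\beta\in\mathfrak{gl}(V)$ is a linear map $\rho:\mathfrak g\to\mathfrak{gl}(V)$ with $\rho(\phi(x))\circ\beta=\beta\circ\rho(x)$ and $\rho([x,y])\circ\beta=\rho(\phi(x))\circ\rho(y)-\rho(\phi(y))\circ\rho(x)$. $\varphi^*f=f\circ\varphi$. A Hom-bundle $(A\to M,\varphi,\phi_A)$ is a vector bundle $A\to M$ with a smooth map $\varphi:M\to M$ and a linear map $\phi_A:\Gamma(A)\to\Gamma(A)$ such that $\phi_A(fx)=\varphi^*(f)\phi_A(x)$.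 $\varphi^!TM$ is the pullback bundle of $TM$; a section $x$ acts on functions by $x(f)(m)=x_m(f)$, where $x_m\in T_{\varphi(m)}M$. As $\varphi$ is a diffeomorphism, $\Gamma(\varphi^!TM)$ is thereby identified with the $(\varphi^*,\varphi^* )$-derivations of $C^\infty(M)$, i.e. linear maps $x$ with $x(fg)=x(f)\varphi^*(g)+\varphi^*(f)x(g)$. A Hom-Lie algebroid $(A,\varphi,\phi_A,[\cdot,\cdot]_A,a_A)$ is a Hom-bundle $(A\to M,\varphi,\phi_A)$ with a Hom-Lie algebra structure $(\Gamma(A),[\cdot,\cdot]_A,\phi_A)$ and a bundle map $a_A:A\to\varphi^!TM$ (anchor) such that (i) $[x,fy]_A=\varphi^*(f)[x,y]_A+a_A(\phi_A(x))(f)\,\phi_A(y)$ for $x,y\in\Gamma(A)$, $f\in C^\infty(M)$; (ii) $a_A$ is a representation of $(\Gamma(A),[\cdot,\cdot]_A,\phi_A)$ on $C^\infty(M)$ with respect to $\varphi^*$. $(\varphi^!TM,\varphi,\mathrm{Ad}_{\varphi^*},[\cdot,\cdot]_{\varphi^*},\mathrm{id})$ is a Hom-Lie algebroid, where $\mathrm{Ad}_{\varphi^*}(x)=\varphi^*\circ x\circ(\varphi^* )^{-1}$ and $[x,y]_{\varphi^*}=\varphi^*\circ x\circ(\varphi^* )^{-1}\circ y\circ(\varphi^* )^{-1}-\varphi^*\circ y\circ(\varphi^* )^{-1}\circ x\circ(\varphi^* )^{-1}$. Write $\phi=\mathrm{Ad}_{\varphi^*}$, extended to $\Gamma(\wedge^k\varphi^!TM)$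 by $\phi(x_1\wedge\cdots\wedge x_k)=\phi(x_1)\wedge\cdots\wedge\phi(x_k)$. On $\Gamma(\varphi^!T^*M)$, with $\varphi^!T^*M=(\varphi^!TM)^*$, $\mathrm{Ad}^\dagger_{\varphi^*}$ is $(\mathrm{Ad}^\dagger_{\varphi^*}\xi)(x)=\varphi^*\big(\xi(\phi^{-1}(x))\big)$. For this Hom-Lie algebroid: $\mathrm{d}f$ is given by $\langle\mathrm{d}f,x\rangle=x(f)$; for $x,y\in\Gamma(\varphi^!TM)$ and $\eta\in\Gamma(\varphi^!T^*M)$ the Lie derivative is $$\langle L_x\eta,y\rangle=\phi(x)\langle\eta,\phi^{-1}(y)\rangle-\langle\mathrm{Ad}^\dagger_{\varphi^*}(\eta),[x,\phi^{-1}(y)]_{\varphi^*}\rangle.$$ The Hom-Schouten bracket for $p,q\ge1$ is $\llbracket x_1\wedge\cdots\wedge x_p,y_1\wedge\cdots\wedge y_q\rrbracket=\sum_{i,j}(-1)^{i+j}[x_i,y_j]_{\varphi^*}\wedge\phi(x_1\wedge\cdots\widehat{x_i}\cdots\wedge x_p\wedge y_1\wedge\cdots\widehat{y_j}\cdots\wedge y_q)$. A Hom-Poisson manifold $(M,\varphi,\pi)$ is a manifold with $\pi\in\Gamma(\wedge^2\varphi^!TM)$ such that $\llbracket\pi,\pi\rrbracket=0$ and $\mathrm{Ad}_{\varphi^*}(\pi)=\pi$. *)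

(* Defs.v *)
From HB Require Import structures.
From mathcomp Require Import all_boot all_order all_algebra.
From mathcomp Require Import all_classical all_reals all_analysis.

Set Implicit Arguments.
Unset Strict Implicit.
Unset Printing Implicit Defensive.
Import Order.TTheory GRing.Theory Num.Theory.
Import numFieldNormedType.Exports.
Local Open Scope classical_set_scope.
Local Open Scope ring_scope.

(** * Smooth functions on open subsets of R^n *)

Section Euclidean.
Context {R : realType} {n : nat}.
Implicit Types (U : set 'rV[R]_n) (f g : 'rV[R]_n -> R^o).

Definition partial (i : 'I_n) f : 'rV[R]_n -> R^o :=
  fun x => 'D_(delta_mx 0 i : 'rV[R]_n) f x.

(* [f] is of class C^k on the open set [U]; values of [f] outside [U] are
   irrelevant. *)
Fixpoint Ck (k : nat) U f : Prop :=
  (forall x, U x -> {for x, continuous f}) /\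
  if k is k'.+1 then
    forall i : 'I_n, (forall x, U x -> derivable f x (delta_mx 0 i : 'rV[R]_n))
                     /\ Ck k' U (partial i f)
  else True.

Definition smooth_on U f : Prop := forall k, Ck k U f.

Lemma Ck_continuous k U f x : Ck k U f -> U x -> {for x, continuous f}.
Proof. by case: k => [|k] [h _] Ux; exact: h. Qed.

Lemma Ck_eq k U f g : open U -> (forall x, U x -> f x = g x) ->
  Ck k U f -> Ck k U g.
Proof.
move=> oU; elim: k f g => [|k IHk] f g fg [fc fd].
all: have nfg x : U x -> \near x, f x = g x
  by move=> Ux; have := open_nbhs_nbhs (conj oU Ux); apply: filterS => y /fg.
all: have gc x : U x -> {for x, continuous g}
  by move=> Ux; rewrite /prop_for /continuous_at -(fg x Ux);
     apply: cvg_trans (fc x Ux); exact: near_eq_cvg (nfg _ Ux).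
  by [].
split=> // i.
have [fdi fk] := fd i; split=> [x Ux|].
  exact: near_eq_derivable (nfg _ Ux) (fdi _ Ux).
apply: IHk fk => x Ux; exact: near_eq_derive (nfg _ Ux).
Qed.

Lemma CkW k U f : Ck k.+1 U f -> Ck k U f.
Proof.
elim: k f => [|k IHk] f [fc fd]; first by split.
by split=> // i; have [fdi fk] := fd i; split=> //; exact: IHk.
Qed.

Lemma Ck_cst k U a : Ck k U (fun=> a).
Proof.
elim: k a => [|k IHk] a.
  by split=> // x _; exact: cst_continuous.
split=> [x _|i]; first exact: cst_continuous.
split=> [x _|]; first exact: derivable_cst.
have -> : partial i (fun=> a) = (fun=> 0); last exact: IHk.
by apply/funext => x; rewrite /partial derive_cst.
Qed.

Lemma CkD k U f g : open U -> Ck k U f -> Ck k U g -> Ck k U (f \+ g).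
Proof.
move=> oU; elim: k f g => [|k IHk] f g [fc fd] [gc gd].
  by split=> // x Ux; apply: continuousD; [exact: fc|exact: gc].
split=> [x Ux|i]; first by apply: continuousD; [exact: fc|exact: gc].
have [fdi fk] := fd i; have [gdi gk] := gd i; split=> [x Ux|].
  by apply: derivableD; [exact: fdi|exact: gdi].
apply: (Ck_eq oU) (IHk _ _ fk gk) => x Ux.
by rewrite /partial/= [RHS]deriveD//; [exact: fdi|exact: gdi].
Qed.

Lemma CkM k U f g : open U -> Ck k U f -> Ck k U g -> Ck k U (f \* g).
Proof.
move=> oU; elim: k f g => [|k IHk] f g.
  by move=> [fc _] [gc _]; split=> // x Ux;
    apply: continuousM; [exact: fc|exact: gc].
move=> fk1 gk1; have [fc fd] := fk1; have [gc gd] := gk1.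
split=> [x Ux|i]; first by apply: continuousM; [exact: fc|exact: gc].
have [fdi fk] := fd i; have [gdi gk] := gd i; split=> [x Ux|].
  by apply: derivableM; [exact: fdi|exact: gdi].
have := CkD oU (IHk _ _ (CkW fk1) gk) (IHk _ _ (CkW gk1) fk).
apply: (Ck_eq oU) => x Ux.
by rewrite /partial/= [RHS]deriveM//; [exact: fdi|exact: gdi].
Qed.

Lemma CkS k U (V : set 'rV[R]_n) f : V `<=` U -> Ck k U f -> Ck k V f.
Proof.
move=> VU; elim: k f => [|k IHk] f [fc fd]; first by split=> // x /VU; exact: fc.
split=> [x /VU|i]; first exact: fc.
have [fdi fk] := fd i; split=> [x /VU|]; [exact: fdi|exact: IHk].
Qed.

End Euclidean.

(** * Smooth manifolds *)

(* A chart is a homeomorphism from the open set [cdom] onto an open subset of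
   R^n; [cmap] and [cinv] are total, with irrelevant values elsewhere. *)
Record chart (R : realType) (n : nat) (M : topologicalType) := Chart {
  cdom : set M;
  cmap : M -> 'rV[R]_n;
  cinv : 'rV[R]_n -> M;
  open_cdom : open cdom;
  open_cimg : open (cmap @` cdom);
  cmapK : forall p, cdom p -> cinv (cmap p) = p;
  cmap_continuous : forall p, cdom p -> {for p, continuous cmap};
  cinv_continuous : forall x, (cmap @` cdom) x -> {for x, continuous cinv} }.

Record manifold (R : realType) (n : nat) := Manifold {
  mcar :> topologicalType;
  atlas : set (chart R n mcar);
  mfd_hausdorff : hausdorff_space mcar;
  mfd_second_countable : @second_countable mcar;
  atlas_cover : forall p, exists2 c, atlas c & cdom c p;
  atlas_smooth : forall c d, atlas c -> atlas d -> forall i,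
    smooth_on (cmap c @` (cdom c `&` cdom d))
              (fun x => cmap d (cinv c x) 0 i) }.

Lemma open_cimgI (R : realType) n (M : topologicalType) (c : chart R n M)
  (W : set M) : open W -> open (cmap c @` (cdom c `&` W)).
Proof.
move=> oW; rewrite openE => _ [p [cp Wp] <-].
have cimg : (cmap c @` cdom c) (cmap c p) by exists p.
have n1 : nbhs (cmap c p) (cmap c @` cdom c).
  by apply: open_nbhs_nbhs; split; [exact: open_cimg|].
have n2 : nbhs (cmap c p) (cinv c @^-1` W).
  apply: (cinv_continuous cimg); rewrite /nbhs_simpl/= cmapK//.
  exact: open_nbhs_nbhs.
apply: filterS (filterI n1 n2) => x [[q cq <-]].
by rewrite /preimage/= cmapK// => Wq; exists q.
Qed.

Section SmoothFunctions.
Context {R : realType} {n : nat} (M : manifold R n).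

(* [f] is smooth on the open subset [W] of [M]. *)
Definition smooth_fun (W : set M) (f : M -> R^o) : Prop :=
  forall c, atlas c -> smooth_on (cmap c @` (cdom c `&` W)) (f \o cinv c).

Lemma smooth_fun_cst W a : smooth_fun W (fun=> a).
Proof. by move=> c _ k; exact: Ck_cst. Qed.

Lemma smooth_funD W f g : open W ->
  smooth_fun W f -> smooth_fun W g -> smooth_fun W (f \+ g).
Proof.
move=> oW fs gs c Ac k; have oc := @open_cimgI _ _ _ c _ oW.
exact: (CkD oc (fs c Ac k) (gs c Ac k)).
Qed.

Lemma smooth_funM W f g : open W ->
  smooth_fun W f -> smooth_fun W g -> smooth_fun W (f \* g).
Proof.
move=> oW fs gs c Ac k; have oc := @open_cimgI _ _ _ c _ oW.
exact: (CkM oc (fs c Ac k) (gs c Ac k)).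
Qed.

Lemma smooth_funS (W V : set M) f : V `<=` W -> smooth_fun W f -> smooth_fun V f.
Proof.
move=> VW fs c Ac k; apply: CkS (fs c Ac k) => _ [p [cp /VW Wp] <-].
by exists p.
Qed.

Definition smooth_pred : {pred M -> R^o} := fun f => `[< smooth_fun setT f >].

Lemma smooth_subring_closed : subring_closed smooth_pred.
Proof.
split=> [|f g|f g]; rewrite ?inE.
- exact: (@smooth_fun_cst setT 1).
- move=> fs gs.
  have -> : f - g = f \+ (fun=> -1 : R^o) \* g.
    by apply/funext => x /=; rewrite mulN1r.
  apply: smooth_funD fs _; first exact: openT.
  by apply: smooth_funM gs; [exact: openT|exact: smooth_fun_cst].
- exact: (smooth_funM openT).
Qed.

HB.instance Definition _ :=
  GRing.isSubringClosed.Build (M -> R^o) smooth_pred smooth_subring_closed.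

Lemma smooth_scaler_closed : GRing.scaler_closed smooth_pred.
Proof.
move=> a f /asboolP fs; apply/asboolP.
exact: (smooth_funM openT (@smooth_fun_cst setT a) fs).
Qed.

HB.instance Definition _ :=
  GRing.isScaleClosed.Build R (M -> R^o) smooth_pred smooth_scaler_closed.

Record cinf := Cinf { cinf_val :> M -> R^o ; _ : cinf_val \in smooth_pred }.
HB.instance Definition _ := [isSub for cinf_val].
HB.instance Definition _ := [Choice of cinf by <:].
HB.instance Definition _ := GRing.SubChoice_isSubComPzRing.Build
  (M -> R^o) smooth_pred cinf smooth_subring_closed.
HB.instance Definition _ := [SubZmodule_isSubLmodule of cinf by <:].

(* The smooth function with underlying map [f].  It is applied below only to
   maps that are smooth (which is why the default value 0 plays no role). *)
Definition to_cinf (f : M -> R^o) : cinf := insubd 0 f.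

End SmoothFunctions.

Record smooth_map (R : realType) (n k : nat) (M : manifold R n)
    (N : manifold R k) := SmoothMap {
  smap :> M -> N;
  smap_continuous : continuous smap;
  smap_smooth : forall c d, atlas c -> atlas d -> forall i,
    smooth_on (cmap c @` (cdom c `&` smap @^-1` cdom d))
              (fun x => cmap d (smap (cinv c x)) 0 i) }.

Record diffeo (R : realType) (n : nat) (M : manifold R n) := Diffeo {
  dfwd :> smooth_map M M;
  dbwd : smooth_map M M;
  dfwdK : cancel dfwd dbwd;
  dbwdK : cancel dbwd dfwd }.

(** * Linear algebra: dual spaces, exterior powers, tangent spaces *)

Section Dual.
Context {R : realType} (V : lmodType R).

Definition linform_pred : {pred V -> R^o} :=
  fun f => `[< forall (a : R) u v, f (a *: u + v) = a * f u + f v >].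

Lemma linform_submod_closed : submod_closed linform_pred.
Proof.
split=> [|a f g /asboolP fl /asboolP gl]; apply/asboolP => b u v /=.
  by rewrite mulr0 addr0.
have E w : (a *: f + g) w = a * f w + g w by [].
by rewrite !E fl gl !mulrDr !mulrA (mulrC a b) addrACA.
Qed.

HB.instance Definition _ :=
  GRing.isSubmodClosed.Build R (V -> R^o) linform_pred linform_submod_closed.

Record dual := Dual { dual_val :> V -> R^o ; _ : dual_val \in linform_pred }.
HB.instance Definition _ := [isSub for dual_val].
HB.instance Definition _ := [Choice of dual by <:].
HB.instance Definition _ := [SubChoice_isSubLmodule of dual by <:].

End Dual.

Section ExteriorPower.
Context {R : realType} (k : nat) (V : lmodType R).

Definition update (xi : 'I_k -> dual V) (i : 'I_k) (u : dual V) :=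
  fun j => if j == i then u else xi j.

(* For finite-dimensional [V], the k-th exterior power of [V] is the space of
   alternating k-linear forms on the dual of [V]. *)
Definition altform_pred : {pred ('I_k -> dual V) -> R^o} := fun P =>
  `[< (forall xi i (a : R) u v,
         P (update xi i (a *: u + v)) =
         a * P (update xi i u) + P (update xi i v)) /\
      (forall xi i j, i != j -> xi i = xi j -> P xi = 0) >].

Lemma altform_submod_closed : submod_closed altform_pred.
Proof.
split=> [|a P Q /asboolP[Pl Pa] /asboolP[Ql Qa]]; apply/asboolP.
  by split=> // xi i b u v; rewrite /= mulr0 addr0.
have E w : (a *: P + Q) w = a * P w + Q w by [].
split=> [xi i b u v|xi i j ij xij].
  by rewrite !E Pl Ql !mulrDr !mulrA (mulrC a b) addrACA.
by rewrite E (Pa _ _ _ ij xij) (Qa _ _ _ ij xij) mulr0 addr0.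
Qed.

HB.instance Definition _ := GRing.isSubmodClosed.Build R
  (('I_k -> dual V) -> R^o) altform_pred altform_submod_closed.

Record ext := Ext {
  ext_val :> ('I_k -> dual V) -> R^o ; _ : ext_val \in altform_pred }.
HB.instance Definition _ := [isSub for ext_val].
HB.instance Definition _ := [Choice of ext by <:].
HB.instance Definition _ := [SubChoice_isSubLmodule of ext by <:].

(* (x_1 /\ ... /\ x_k)(xi_1, ..., xi_k) = det (xi_a(x_b)), for example
   (x /\ y)(xi, eta) = xi(x) eta(y) - xi(y) eta(x). *)
Lemma wedge_subproof (x : 'I_k -> V) :
  (fun xi : 'I_k -> dual V => \det (\matrix_(a, b) (xi a (x b) : R)) : R^o) \in altform_pred.
Proof.
apply/asboolP; split=> [xi i a u v|xi i j ij xij].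
  pose A w : 'M[R]_k := \matrix_(p, b) (update xi i w p (x b) : R).
  rewrite -/(A _) -/(A u) -/(A v).
  rewrite (@determinant_multilinear _ _ _ (A u) (A v) i a 1) ?mul1r//.
  - by apply/rowP => b; rewrite !mxE /update !eqxx mul1r.
  - apply/matrixP => p b; rewrite !mxE /update.
    by rewrite eq_sym (negPf (neq_lift _ _)).
  - apply/matrixP => p b; rewrite !mxE /update.
    by rewrite eq_sym (negPf (neq_lift _ _)).
by apply: (determinant_alternate ij) => b; rewrite !mxE xij.
Qed.

Definition wedge (x : 'I_k -> V) : ext := Ext (wedge_subproof x).

End ExteriorPower.

(* The tangent space of [M] at [p] is the space of derivations of C^oo(M) at
   [p]. *)
Section Tangent.
Context {R : realType} {n : nat} (M : manifold R n) (p : M).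

Definition derivation_pred : {pred cinf M -> R^o} := fun v =>
  `[< (forall (a : R) f g, v (a *: f + g) = a * v f + v g) /\
      (forall f g : cinf M, v (f * g) = v f * g p + f p * v g) >].

Lemma derivation_submod_closed : submod_closed derivation_pred.
Proof.
split=> [|a v w /asboolP[vl vM] /asboolP[wl wM]]; apply/asboolP.
  by split=> * /=; rewrite ?mulr0 ?mul0r addr0.
have E h : (a *: v + w) h = a * v h + w h by [].
split=> [b f g|f g]; rewrite !E.
  by rewrite vl wl !mulrDr !mulrA (mulrC a b) addrACA.
by rewrite vM wM !mulrDr mulrDl !mulrA (mulrC (f p) a) addrACA.
Qed.

HB.instance Definition _ := GRing.isSubmodClosed.Build R
  (cinf M -> R^o) derivation_pred derivation_submod_closed.

Record tangent := Tangent {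
  tan_val :> cinf M -> R^o ; _ : tan_val \in derivation_pred }.
HB.instance Definition _ := [isSub for tan_val].
HB.instance Definition _ := [Choice of tangent by <:].
HB.instance Definition _ := [SubChoice_isSubLmodule of tangent by <:].

(* The i-th coordinate vector of the chart [c] at [p]; it is a derivation
   whenever [p] is in the domain of [c]. *)
Definition coord_vec (c : chart R n M) (i : 'I_n) : tangent :=
  insubd 0 (fun f : cinf M => partial i (f \o cinv c) (cmap c p)).

End Tangent.

(** * Vector bundles *)

(* The data of a vector bundle over [M]: its fibres and a family of local
   frames, indexed by the finite type [bidx]. *)
Record frame (R : realType) (n : nat) (M : manifold R n) (I : finType)
    (F : M -> lmodType R) := Frame {
  fdom : set M;
  open_fdom : open fdom;
  fvec : I -> forall p, F p }.

Record prebundle (R : realType) (n : nat) (M : manifold R n) := Prebundle {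
  fib : M -> lmodType R;
  bidx : finType;
  frames : set (frame bidx fib) }.

Section Bundles.
Context {R : realType} {n : nat} {M : manifold R n}.

Definition rawsec (E : prebundle M) := forall p : M, fib E p.

(* [s] is smooth on the open set [W]: it has smooth components in each frame. *)
Definition smooth_section (E : prebundle M) (W : set M) (s : rawsec E) : Prop :=
  forall F, frames F -> exists c : bidx E -> M -> R^o,
    (forall i, smooth_fun (W `&` fdom F) (c i)) /\
    (forall p, W p -> fdom F p -> s p = \sum_i c i p *: fvec F i p).

Definition is_vector_bundle (E : prebundle M) : Prop :=
  [/\ forall p, exists2 F : frame (bidx E) (fib E), frames F & fdom F p,
      forall F : frame (bidx E) (fib E), frames F -> forall p, fdom F p ->
        forall v : fib E p, exists! w : {ffun bidx E -> R},
          v = \sum_i w i *: fvec F i p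
    & forall F : frame (bidx E) (fib E), frames F -> forall i,
        smooth_section (fdom F) (fvec F i)].

Section RawSections.
Variable E : prebundle M.

HB.instance Definition _ := gen_eqMixin (rawsec E).
HB.instance Definition _ := gen_choiceMixin (rawsec E).

Let add (s t : rawsec E) : rawsec E := fun p => s p + t p.
Let opp (s : rawsec E) : rawsec E := fun p => - s p.
Let zero : rawsec E := fun=> 0.
Let scale (a : R) (s : rawsec E) : rawsec E := fun p => a *: s p.

Let addA : associative add.
Proof. by move=> s t u; apply: functional_extensionality_dep => p; exact: addrA. Qed.
Let addC : commutative add.
Proof. by move=> s t; apply: functional_extensionality_dep => p; exact: addrC. Qed.
Let add0 : left_id zero add.
Proof. by move=> s; apply: functional_extensionality_dep => p; exact: add0r. Qed.
Let addN : left_inverse zero opp add.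
Proof. by move=> s; apply: functional_extensionality_dep => p; exact: addNr. Qed.

HB.instance Definition _ := GRing.isZmodule.Build (rawsec E) addA addC add0 addN.

Let scaleA a b s : scale a (scale b s) = scale (a * b) s.
Proof. by apply: functional_extensionality_dep => p; exact: scalerA. Qed.
Let scale1 : left_id 1 scale.
Proof. by move=> s; apply: functional_extensionality_dep => p; exact: scale1r. Qed.
Let scaleDr : right_distributive scale +%R.
Proof. by move=> a s t; apply: functional_extensionality_dep => p; exact: scalerDr. Qed.
Let scaleDl s : {morph scale^~ s : a b / a + b}.
Proof. by move=> a b; apply: functional_extensionality_dep => p; exact: scalerDl. Qed.

HB.instance Definition _ := GRing.Zmodule_isLmodule.Build R (rawsec E)
  scaleA scale1 scaleDr scaleDl.

Definition smooth_sec_pred : {pred rawsec E} :=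
  fun s => `[< smooth_section setT s >].

Lemma smooth_section_comb (f : M -> R^o) (s t : rawsec E) :
  smooth_fun setT f -> smooth_section setT s -> smooth_section setT t ->
  smooth_section setT ((fun p => f p *: s p + t p) : rawsec E).
Proof.
move=> fs ss ts F FF; have [c [cs cE]] := ss F FF; have [d [ds dE]] := ts F FF.
have oF : open (setT `&` fdom F) by rewrite setTI; exact: open_fdom.
exists (fun i => (f \* c i) \+ d i); split=> [i|p _ Fp].
  apply: smooth_funD => //; apply: smooth_funM => //.
  by apply: smooth_funS fs => q.
rewrite cE// dE// scaler_sumr -big_split; apply: eq_bigr => i _ /=.
by rewrite scalerA -scalerDl.
Qed.

Lemma smooth_section0 : smooth_section setT (0 : rawsec E).
Proof.
move=> F FF; exists (fun _ _ => 0); split=> [i|p _ _]; first exact: smooth_fun_cst.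
by rewrite big1// => i _; rewrite scale0r.
Qed.

Lemma smooth_sec_submod_closed : submod_closed smooth_sec_pred.
Proof.
split=> [|a s t /asboolP ss /asboolP ts]; apply/asboolP.
  exact: smooth_section0.
have := smooth_section_comb (@smooth_fun_cst R n M setT a) ss ts.
by [].
Qed.

HB.instance Definition _ := GRing.isSubmodClosed.Build R (rawsec E)
  smooth_sec_pred smooth_sec_submod_closed.

(* [sec E] is the space of smooth global sections of [E] *)
Record sec := Sec { sec_val : rawsec E ; _ : sec_val \in smooth_sec_pred }.
HB.instance Definition _ := [isSub for sec_val].
HB.instance Definition _ := [Choice of sec by <:].
HB.instance Definition _ := [SubChoice_isSubLmodule of sec by <:].

Definition sec_at (s : sec) (p : M) : fib E p := sec_val s p.

Lemma smul_subproof (f : cinf M) (s : sec) :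
  ((fun p => f p *: sec_val s p) : rawsec E) \in smooth_sec_pred.
Proof.
apply/asboolP; have fs : smooth_fun setT f by apply/asboolP; exact: (valP f).
have ss : smooth_section setT (sec_val s) by apply/asboolP; exact: (valP s).
have := smooth_section_comb fs ss smooth_section0.
by congr smooth_section; apply: functional_extensionality_dep => p; rewrite addr0.
Qed.

Definition smul (f : cinf M) (s : sec) : sec := Sec (smul_subproof f s).

End RawSections.

Coercion sec_at : sec >-> Funclass.

Definition tangent_bundle : prebundle M :=
  @Prebundle _ _ M (fun p => tangent p) 'I_n
    [set F | exists2 c, atlas c &
       F = Frame (open_cdom c) (fun i p => coord_vec p c i)].

Lemma open_preimage_smap (phi : smooth_map M M) (A : set M) :
  open A -> open (phi @^-1` A).
Proof. by apply: open_comp => p _; exact: smap_continuous. Qed.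

Definition pullback (phi : smooth_map M M) (E : prebundle M) : prebundle M :=
  @Prebundle _ _ M (fun p => fib E (phi p)) (bidx E)
    [set G | exists2 F, frames F &
       G = Frame (open_preimage_smap phi (open_fdom F))
                 (fun i p => fvec F i (phi p))].

(* The dual frame is characterized by its values on the given frame. *)
Definition dual_bundle (E : prebundle M) : prebundle M :=
  @Prebundle _ _ M (fun p => dual (fib E p)) (bidx E)
    [set G | exists2 F, frames F &
       G = Frame (open_fdom F) (fun i p =>
             xget 0 [set xi : dual (fib E p) |
               forall j, xi (fvec F j p) = (j == i)%:R])].

(* Frames: wedges of k distinct frame vectors, one for each k-element subset. *)
Definition ext_bundle (k : nat) (E : prebundle M) : prebundle M :=
  let idx : finType := {S : {set bidx E} | #|S| == k} in
  let nth (S : idx) (a : 'I_k) : bidx E :=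
    @enum_val _ (mem (val S)) (cast_ord (esym (eqP (valP S))) a) in
  @Prebundle _ _ M (fun p => ext k (fib E p)) idx
    [set G | exists2 F, frames F &
       G = Frame (open_fdom F)
             (fun S p => wedge (fun a => fvec F (nth S a) p))].

Definition is_bundle_map (A B : prebundle M)
    (a : forall p, fib A p -> fib B p) : Prop :=
  (forall p, linear (a p)) /\
  (forall F : frame (bidx A) (fib A), frames F -> forall i,
     smooth_section (E := B) (fdom F) (fun p => a p (fvec F i p))).

(* The map on smooth sections induced by a bundle map: smoothness of the bundle
   map makes the image smooth, so the default value 0 plays no role. *)
Definition sec_map (A B : prebundle M) (a : forall p, fib A p -> fib B p)
  (x : sec A) : sec B := insubd 0 ((fun p => a p (x p)) : rawsec B).

End Bundles.

(** * Hom-Lie algebras and Hom-Lie algebroids *)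

Definition is_hom_lie_algebra (R : realType) (g : lmodType R)
    (br : g -> g -> g) (phi : g -> g) : Prop :=
  [/\ (forall x, linear (br x)) /\ (forall y, linear (br^~ y)),
      forall x y, br x y = - br y x,
      linear phi,
      forall x y, phi (br x y) = br (phi x) (phi y)
    & forall x y z, br (phi x) (br y z) + br (phi y) (br z x)
                    + br (phi z) (br x y) = 0].

Definition is_representation (R : realType) (g V : lmodType R)
    (br : g -> g -> g) (phi : g -> g) (beta : V -> V) (rho : g -> V -> V) : Prop :=
  [/\ linear beta,
      (forall x, linear (rho x)) /\ (forall v, linear (rho^~ v)),
      forall x v, rho (phi x) (beta v) = beta (rho x v)
    & forall x y v, rho (br x y) (beta v)
                    = rho (phi x) (rho y v) - rho (phi y) (rho x v)].

Section HomAlgebroids.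
Context {R : realType} {n : nat} {M : manifold R n}.

Definition pull_fun (phi : smooth_map M M) (f : cinf M) : cinf M :=
  to_cinf (f \o phi).

Definition pull_tangent (phi : smooth_map M M) : prebundle M :=
  pullback phi tangent_bundle.

(* x(f)(m) = x_m(f) *)
Definition act (phi : smooth_map M M) (x : sec (pull_tangent phi))
  (f : cinf M) : cinf M := to_cinf (fun m => (x m : tangent (phi m)) f).

Definition is_hom_bundle (phi : smooth_map M M) (A : prebundle M)
    (phiA : sec A -> sec A) : Prop :=
  [/\ is_vector_bundle A, linear phiA
    & forall f x, phiA (smul f x) = smul (pull_fun phi f) (phiA x)].

Definition is_hom_lie_algebroid (phi : smooth_map M M) (A : prebundle M)
    (phiA : sec A -> sec A) (br : sec A -> sec A -> sec A)
    (anchor : forall p, fib A p -> fib (pull_tangent phi) p) : Prop :=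
  let a x := act (phi := phi) (sec_map anchor x) in
  [/\ is_hom_bundle phi phiA,
      is_hom_lie_algebra br phiA,
      is_bundle_map anchor,
      forall x y f, br x (smul f y)
        = smul (pull_fun phi f) (br x y) + smul (a (phiA x) f) (phiA y)
    & is_representation br phiA (pull_fun phi) a].

End HomAlgebroids.

(** * Calculus on the pullback tangent bundle of a diffeomorphism *)

Section Calculus.
Context {R : realType} {n : nat} {M : manifold R n} (phi : diffeo M).

Local Notation T := (pull_tangent phi).
Local Notation T' := (dual_bundle T).
Local Notation phis := (pull_fun phi).
Local Notation phisV := (pull_fun (dbwd phi)).

(* The section acting on functions as [D], where D is a derivation twisted by
   [phis], that is, D(fg) = D(f) phis(g) + phis(f) D(g). *)
Definition sec_of_derivation (D : cinf M -> cinf M) : sec T :=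
  xget 0 [set x | forall f, act x f = D f].

Definition Ad (x : sec T) : sec T :=
  sec_of_derivation (fun f => phis (act x (phisV f))).

Definition AdV (x : sec T) : sec T :=
  sec_of_derivation (fun f => phisV (act x (phis f))).

Definition bracket (x y : sec T) : sec T := sec_of_derivation (fun f =>
  phis (act x (phisV (act y (phisV f)))) -
  phis (act y (phisV (act x (phisV f))))).

Definition pairing (xi : sec T') (x : sec T) : cinf M :=
  to_cinf (fun m => (xi m : dual (fib T m)) (x m)).

(* The section of the dual bundle given by the C^oo(M)-linear form [F]. *)
Definition sec_of_form (F : sec T -> cinf M) : sec T' :=
  xget 0 [set xi | forall x, pairing xi x = F x].

Definition Ad_dag (xi : sec T') : sec T' :=
  sec_of_form (fun x => phis (pairing xi (AdV x))).

Definition dif (f : cinf M) : sec T' := sec_of_form (fun x => act x f).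

Definition lie (x : sec T) (eta : sec T') : sec T' := sec_of_form (fun y =>
  act (Ad x) (pairing eta (AdV y)) - pairing (Ad_dag eta) (bracket x (AdV y))).

Definition wedge_sec (k : nat) (x : 'I_k -> sec T) : rawsec (ext_bundle k T) :=
  fun m => wedge (fun a => x a m).

(* The Hom-Schouten bracket of x_0 /\ ... /\ x_p and y_0 /\ ... /\ y_q; the
   degrees of the arguments are p+1 and q+1. *)
Definition schouten_wedge (p q : nat) (x : 'I_p.+1 -> sec T)
    (y : 'I_q.+1 -> sec T) : rawsec (ext_bundle (p + q).+1 T) :=
  \sum_(i < p.+1) \sum_(j < q.+1) (-1) ^+ (i + j) *: wedge_sec (fun a : 'I_(p + q).+1 =>
    match unlift ord0 a with
    | None => bracket (x i) (y j)
    | Some b => match fintype.split (b : 'I_(p + q)) with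
                | inl b1 => Ad (x (lift i b1))
                | inr b2 => Ad (y (lift j b2))
                end
    end).

(* Every section of an exterior power is a finite sum of wedges of global
   sections, so that the formulas for wedges determine the following two
   operations by additivity; they are given by their graphs.
   [is_schouten P Q S]: the Hom-Schouten bracket of P and Q is S.
   [is_Ad P Q]: the extension of Ad to the k-th exterior power maps P to Q. *)
Definition is_schouten (p q : nat) (P : sec (ext_bundle p.+1 T))
    (Q : sec (ext_bundle q.+1 T)) (S : sec (ext_bundle (p + q).+1 T)) : Prop :=
  exists (xs : seq ('I_p.+1 -> sec T)) (ys : seq ('I_q.+1 -> sec T)),
    [/\ sec_val P = \sum_(x <- xs) wedge_sec x,
        sec_val Q = \sum_(y <- ys) wedge_sec y
      & sec_val S = \sum_(x <- xs) \sum_(y <- ys) schouten_wedge x y].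

Definition is_Ad (k : nat) (P Q : sec (ext_bundle k T)) : Prop :=
  exists xs : seq ('I_k -> sec T),
    sec_val P = \sum_(x <- xs) wedge_sec x /\
    sec_val Q = \sum_(x <- xs) wedge_sec (Ad \o x).

Definition is_hom_poisson (pi : sec (ext_bundle 2 T)) : Prop :=
  is_schouten pi pi 0 /\ is_Ad pi pi.

Section Poisson.
Variable pi : sec (ext_bundle 2 T).

Definition pi_at (m : M) (xi eta : dual (fib T m)) : R :=
  (pi m : ext 2 (fib T m)) (fun i => if i == ord0 then xi else eta).

(* The value lies in the bidual of the fibre, identified with the fibre. *)
Definition sharp (m : M) (xi : fib T' m) : fib T m :=
  xget 0 [set v | forall eta : dual (fib T m), eta v = pi_at xi eta].

Definition pi_form (xi eta : sec T') : cinf M :=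
  to_cinf (fun m => pi_at (xi m) (eta m)).

Definition poisson_bracket (xi eta : sec T') : sec T' :=
  lie (sec_map sharp xi) eta - lie (sec_map sharp eta) xi
  - dif (pi_form xi eta).

End Poisson.

End Calculus.

(* Main.v *)
(* Under x = X o phi^* the sections of the pullback tangent bundle are the
   vector fields X of M, and the cotangent bracket is phi^* applied to the
   bracket of the Poisson bivector.  With J(f, g) = pi(df, dg) one finds
   [df, dg] = d J(f, g) and Ad^dagger(df) = d(phi^* f), and evaluating the
   Schouten bracket [[pi, pi]] on differentials gives the twisted Jacobi identity
   of J.  The Leibniz rule, a direct computation, makes the defect of the anchor
   from being a representation and the Jacobiator of the bracket tensorial, up to
   powers of phi^*; as forms are locally generated by differentials, both vanish
   because they vanish on differentials.

   The analytic input is that tensorial forms and twisted derivations are given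
   by smooth sections.  It rests on bump functions and on Hadamard's lemma: the
   quotients g_i in f(x) - f(p) = sum_i (x_i - p_i) g_i(x) are the smooth
   functions g_i(x) = int_0^1 (d_i f) (p + s(x - p)) ds, whence the coordinate
   vectors at a point form a basis of its derivations. *)
From HB Require Import structures.
Require Import Defs.
From mathcomp Require Import all_boot all_order all_algebra.
From mathcomp Require Import all_classical all_reals all_analysis.
From mathcomp Require Import ring lra.

Set Implicit Arguments.
Unset Strict Implicit.
Unset Printing Implicit Defensive.
Import Order.TTheory GRing.Theory Num.Theory.
Import numFieldNormedType.Exports.
Local Open Scope classical_set_scope.
Local Open Scope ring_scope.

(** * Differential calculus on open subsets of R^n *)

(** Vectors, sections and forms given by formulas are defined through [xget] or [insubd] with a
    default value. Each formula must therefore first be shown to define a smooth object; this is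
    where tensoriality and locality enter. Afterwards identities between sections are tested on
    functions ([act_inj]) or on sections ([pairing_inj]).

    The vanishing of the Schouten bracket is stated for two decompositions of [pi] into wedges,
    which may differ. Nesting the bracket with the first outside and the second inside produces only
    one half of each commutator [[x_i, y_j]], so the mirror image has to be added; hence twice the
    Jacobiator.

    The anchor has to be treated before the Jacobi identity, because the tensoriality of the
    Jacobiator uses the representation property. Both defects are tensorial only up to pullback by
    [phi] or its square, so their vanishing at [m] is tested with a bump function at the image of
    [m] under that power of [phi]. *)

Section Line.
Context {R : realType} {V : normedModType R}.
Implicit Types (f : V -> R^o).

Lemma is_derive_line f (z e : V) (s : R) : derivable f (s *: e + z) e ->
  is_derive s 1 (fun t : R => f (t *: e + z) : R^o) ('D_e f (s *: e + z)).
Proof.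
move=> df.
have E : (fun h : R => h^-1 *: (((fun t : R => f (t *: e + z)) \o shift s) (h *: 1)
                                - f (s *: e + z)))
   = (fun h : R => h^-1 *: ((f \o shift (s *: e + z)) (h *: e) - f (s *: e + z))).
  by apply/funext => h /=; rewrite [h *: 1]mulr1 scalerDl addrA.
by apply: DeriveDef; rewrite /derivable /derive E.
Qed.

(** Bounding absolute values lets one statement cover displacements of both signs, as coordinate
    increments require; the proof applies the mean value theorem on [[0, t]] or on [[t, 0]]. *)
Lemma MVT_line f (z e : V) (t : R) :
  (forall s : R, `|s| <= `|t| -> derivable f (s *: e + z) e) ->
  exists2 c : R, `|c| <= `|t| & f (t *: e + z) - f z = t * 'D_e f (c *: e + z).
Proof.
move=> df.
pose g (s : R) : R^o := f (s *: e + z); pose dg (s : R) : R^o := 'D_e f (s *: e + z).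
have dgE (s : R) : `|s| <= `|t| -> is_derive s 1 g (dg s).
  by move=> st; apply: is_derive_line; exact: df.
have cg (a b : R) : (forall s, s \in `[a, b] -> `|s| <= `|t|) -> {within `[a, b], continuous g}.
  move=> ab; apply: derivable_within_continuous => s /ab /dgE.
  by case.
have g0 : g 0 = f z by rewrite /g scale0r add0r.
have [t0|t0] := leP 0 t.
  have I (s : R) : s \in `[0, t] -> `|s| <= `|t|.
    by rewrite in_itv /= => /andP[s0 st]; rewrite !ger0_norm.
  have [|c cI E] := @MVT_segment R g dg 0 t t0 _ (cg _ _ I).
    by move=> x /subset_itv_oo_cc/I/dgE.
  exists c; first exact: I.
  by rewrite -g0 -/(g t) E subr0 mulrC.
have I (s : R) : s \in `[t, 0] -> `|s| <= `|t|.
  by rewrite in_itv /= => /andP[ts s0]; rewrite !ler0_norm ?lerN2 // ltW.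
have [|c cI E] := @MVT_segment R g dg t 0 (ltW t0) _ (cg _ _ I).
  by move=> x /subset_itv_oo_cc/I/dgE.
exists c; first exact: I.
by rewrite -g0 -/(g t) -opprB E sub0r mulrN opprK mulrC.
Qed.
End Line.

Section C1Differentiable.
Context {R : realType} {n : nat}.
Implicit Types (U : set 'rV[R]_n) (f : 'rV[R]_n -> R^o).

Definition row_trunc (k : nat) (h : 'rV[R]_n) : 'rV[R]_n :=
  \row_i (if (i < k)%N then h 0 i else 0).

Lemma row_truncS (k : 'I_n) h :
  row_trunc k.+1 h = h 0 k *: delta_mx 0 k + row_trunc k h.
Proof.
apply/rowP => i; rewrite !mxE eqxx /= ltnS leq_eqVlt.
have [->|ik] := eqVneq i k; first by rewrite eqxx ltnn mulr1 addr0.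
by rewrite (negPf (ik : (val i) != val k)) mulr0 add0r.
Qed.

Lemma row_norm_le (h : 'rV[R]_n) (r : R) : 0 <= r ->
  (`|h| <= r) = [forall i, `|h 0 i| <= r].
Proof.
move=> r0; apply/idP/forallP => [hr i|hr].
  apply: le_trans hr; rewrite /Num.norm/= mx_normrE.
  by apply: le_trans (le_bigmax _ _ (0, i)).
rewrite /Num.norm/= mx_normrE; apply: bigmax_le => // -[j i] _ /=.
by rewrite (ord1 j).
Qed.

Lemma coord_norm_le (h : 'rV[R]_n) i : `|h 0 i| <= `|h|.
Proof. by have := row_norm_le h (normr_ge0 h); rewrite lexx => /esym/forallP. Qed.

(* The increment is split into moves along one coordinate at a time, with the
   mean value theorem applied to each of them. *)
Lemma C1_expansion f a (e d : R) : 0 < d ->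
  (forall x : 'rV[R]_n, `|x - a| < d -> forall i : 'I_n, derivable f x (delta_mx 0 i) /\
     `|partial i f x - partial i f a| <= e) ->
  forall h : 'rV[R]_n, `|h| < d ->
    `|f (h + a) - f a - \sum_i h 0 i * partial i f a| <= n%:R * e * `|h|.
Proof.
move=> d0 fd h hd.
have tele : f (h + a) - f a
    = \sum_(i < n) (f (row_trunc i.+1 h + a) - f (row_trunc i h + a)).
  rewrite -(big_mkord xpredT (fun i => f (row_trunc i.+1 h + a) - f (row_trunc i h + a))).
  rewrite (telescope_sumr (fun i => f (row_trunc i h + a)))//; congr (f (_ + _) - f _).
    by apply/rowP => i; rewrite mxE ltn_ord.
  by rewrite -[LHS]add0r; congr +%R; apply/rowP => i; rewrite !mxE.
rewrite tele -sumrB; apply: le_trans (ler_norm_sum _ _ _) _.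
rewrite -mulrA -[n in n%:R]card_ord mulr_natl -sumr_const; apply: ler_sum => k _.
have near_a (s : R) : `|s| <= `|h 0 k| ->
    `|(s *: delta_mx 0 k + (row_trunc k h + a)) - a| < d.
  move=> sh; apply: le_lt_trans hd; rewrite addrA addrK row_norm_le//.
  apply/forallP => i; rewrite !mxE eqxx /=.
  have [->|ik] := eqVneq i k.
    by rewrite mulr1 ltnn addr0; apply: le_trans sh _; exact: coord_norm_le.
  by rewrite mulr0 add0r; case: ifP => _; [exact: coord_norm_le|rewrite normr0].
rewrite row_truncS -[_ + _ + a]addrA.
have [|c /near_a/fd/(_ k)[_ cE] ->] := @MVT_line R _ f (row_trunc k h + a) (delta_mx 0 k) (h 0 k).
  by move=> s /near_a/fd/(_ k)[].
rewrite -mulrBr normrM mulrC; apply: ler_pM => //.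
exact: coord_norm_le.
Qed.

Lemma C1_differentiable U f a : open U -> Ck 1 U f -> U a ->
  differentiable f a /\ forall v, 'D_v f a = \sum_i v 0 i * partial i f a.
Proof.
move=> oU [fc fd] Ua.
pose L (h : 'rV[R]_n) : R^o := \sum_i h 0 i * partial i f a.
have Ll : linear L.
  move=> c u v; rewrite /L scaler_sumr -big_split; apply: eq_bigr => i _ /=.
  by rewrite !mxE mulrDl -mulrA.
pose Lmx := GRing.isLinear.Build R 'rV[R]_n R^o *:%R L Ll.
pose LL : {linear 'rV[R]_n -> R^o} := HB.pack L Lmx.
have cL : continuous LL.
  move=> x; apply: (@differentiable_continuous _ _ _ x LL).
  have -> : (LL : _ -> R^o) = \sum_i (fun h : 'rV[R]_n => h 0 i * partial i f a : R^o).
    by apply/funext => h; rewrite fct_sumE.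
  apply: differentiable_sum => i; apply: differentiableM => //.
  exact: differentiable_coord.
have expand : forall e : R, 0 < e -> \forall h \near (0 : 'rV[R]_n),
    `|f (h + a) - f a - L h| <= e * `|h|.
  (* [C1_expansion] loses a factor [n]; dividing by [n + 1] absorbs it and stays meaningful for
     [n = 0]. *)
  move=> e e0; pose e' := e / (n.+1)%:R; have e'0 : 0 < e' by rewrite divr_gt0.
  have : \forall x \near a, forall i : 'I_n, derivable f x (delta_mx 0 i) /\
     `|partial i f x - partial i f a| <= e'.
    apply: (@filter_forall _ _ (fun (i : 'I_n) x => derivable f x (delta_mx 0 i) /\
      `|partial i f x - partial i f a| <= e') (nbhs a) _) => i; have [dU [cU _]] := fd i.
    have nU : \forall x \near a, U x by apply: open_nbhs_nbhs.
    have := cU a Ua; rewrite /prop_for /continuous_at => /cvgrPdist_le /(_ e' e'0) cU'.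
    near=> x; split; first by apply: dU; near: x.
    by rewrite distrC; near: x.
  move=> /nbhs_ballP[d /= d0 bd].
  have /C1_expansion H : forall x, `|x - a| < d -> forall i : 'I_n, derivable f x (delta_mx 0 i) /\
     `|partial i f x - partial i f a| <= e'.
    by move=> x xa; apply: bd; rewrite -ball_normE /= distrC.
  apply/nbhs_ballP; exists d => //= h; rewrite -ball_normE /= sub0r normrN => hd.
  apply: le_trans (H d0 h hd) _.
  rewrite ler_wpM2r// /e' mulrCA ger_pMr// ler_pdivrMr// mul1r ler_nat.
  by [].
have dfL : f \o shift a = cst (f a) + LL +o_ (0 : 'rV[R]_n) id.
  apply/eqaddoP => e e0; have := expand e e0; apply: filterS => h.
  by rewrite /= !fctE /= opprD addrA.
have dE := diff_unique cL dfL.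
have df : differentiable f a by apply/diff_locallyP; rewrite dE.
by split=> // v; rewrite deriveE// dE.
Unshelve. all: by end_near. Qed.
End C1Differentiable.

(** * The chain rule and composition of C^k maps *)

Section CkComposition.
Context {R : realType}.

Lemma Ck_local n k (U : set 'rV[R]_n) f :
  (forall x, U x -> exists2 V, V x & Ck k V f) -> Ck k U f.
Proof.
elim: k f => [|k IHk] f loc.
  by split=> // x Ux; have [V Vx [fc _]] := loc x Ux; exact: fc.
split=> [x Ux|i]; first by have [V Vx [fc _]] := loc x Ux; exact: fc.
split=> [x Ux|]; first by have [V Vx [_ /(_ i)[fd _]]] := loc x Ux; exact: fd.
by apply: IHk => x Ux; have [V Vx [_ /(_ i)[_ fd]]] := loc x Ux; exists V.
Qed.

Lemma Ck_sum n k (U : set 'rV[R]_n) (I : Type) (r : seq I) (f : I -> 'rV[R]_n -> R^o) :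
  open U -> (forall i, Ck k U (f i)) -> Ck k U (fun x => \sum_(i <- r) f i x).
Proof.
move=> oU fk; elim: r => [|i r IHr].
  have -> : (fun x => \sum_(i <- [::]) f i x) = (fun=> 0 : R^o) :> (_ -> R^o).
    by apply/funext => x; rewrite big_nil.
  exact: Ck_cst.
have -> : (fun x => \sum_(i <- i :: r) f i x)
    = (f i \+ (fun x => \sum_(i <- r) f i x)) :> ('rV[R]_n -> R^o).
  by apply/funext => x; rewrite big_cons.
exact: CkD.
Qed.

Lemma Ck_coord n k (U : set 'rV[R]_n) (i : 'I_n) : Ck k U (fun x => x 0 i).
Proof.
have dc x : differentiable (fun x : 'rV[R]_n => x 0 i : R^o) x by exact: differentiable_coord.
case: k => [|k]; split=> //.
- by move=> x _; exact: differentiable_continuous.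
- by move=> x _; exact: differentiable_continuous.
move=> j; split=> [x _|]; first exact: diff_derivable.
have -> : partial j (fun x : 'rV[R]_n => x 0 i) = fun=> ((delta_mx 0 j : 'rV[R]_n) 0 i : R^o).
  apply/funext => x; rewrite /partial; apply/cvg_lim => //; apply: cvg_near_cst.
  near=> h; rewrite /= !mxE addrK scalerA mulVf ?scale1r//; near: h.
  exact: nbhs_dnbhs_neq.
exact: Ck_cst.
Unshelve. all: by end_near. Qed.

Lemma continuous_row n (T : topologicalType) (F : T -> 'rV[R]_n) x :
  (forall j, {for x, continuous (fun y => F y 0 j : R^o)}) -> {for x, continuous F}.
Proof.
move=> cF; apply/cvgrPdist_le => e e0.
have : \forall y \near x, forall j : 'I_n, `|F x 0 j - F y 0 j| <= e.
  apply: (@filter_forall _ _ (fun (j : 'I_n) y => `|F x 0 j - F y 0 j| <= e) (nbhs x) _) => j.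
  by have := cF j => /cvgrPdist_le/(_ e e0).
apply: filterS => y ye; rewrite row_norm_le ?ltW//; apply/forallP => j.
by rewrite !mxE.
Qed.

Section ChainRule.
Context {n m : nat} {U : set 'rV[R]_n} {V : set 'rV[R]_m}
  {F : 'rV[R]_n -> 'rV[R]_m} {f : 'rV[R]_m -> R^o}.
Hypotheses (oU : open U) (oV : open V) (FUV : forall x, U x -> V (F x))
  (F1 : forall j, Ck 1 U (fun x => F x 0 j)) (f1 : Ck 1 V f).

(** Restricting [F] to the line through [x] in direction [i] gives a curve [c]. A C^1 function [f]
    is Frechet differentiable by [C1_differentiable], so it can be composed with this curve. *)
Lemma chain_rule x i : U x -> derivable (f \o F) x (delta_mx 0 i : 'rV[R]_n) /\
  partial i (f \o F) x
    = \sum_j partial i (fun y => F y 0 j) x * partial j f (F x).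
Proof.
move=> Ux; pose e : 'rV[R]_n := delta_mx 0 i; pose c (h : R) := F (h *: e + x).
have dFj j : derivable (fun y => F y 0 j : R^o) x e.
  by have [_ /(_ i)[Fd _]] := F1 j; exact: Fd.
have c0 : c 0 = F x by rewrite /c scale0r add0r.
have isF : is_derive (0 : R) 1 c (\row_j partial i (fun y => F y 0 j) x).
  have dc : derivable c 0 1.
    apply/derivable_mxP => j j'; rewrite (ord1 j).
    exact: (iffLR (derivable1P (fun y => F y 0 j' : R^o) x e) (dFj j')).
  apply: DeriveDef => //; rewrite (derive_mx dc); apply/rowP => j; rewrite !mxE.
  have := @is_derive_line _ _ (fun y => F y 0 j : R^o) x e 0.
  by rewrite scale0r add0r => /(_ (dFj j)) H; exact: (@derive_val _ _ _ _ _ _ _ H).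
have [df fE] := C1_differentiable oV f1 (FUV Ux).
have diffc : differentiable c 0 by apply/derivable1_diffP; case: isF.
have diffcf : differentiable (f \o c) 0 by apply: differentiable_comp => //; rewrite c0.
have dfF : derivable (f \o F) x e.
  by apply/derivable1P/derivable1_diffP.
split=> //; have := @is_derive_line _ _ (f \o F : _ -> R^o) x e 0.
rewrite scale0r add0r => /(_ dfF) H; have {H} := @derive_val _ _ _ _ _ _ _ H.
rewrite -[fun t : R => _]/(f \o c) deriveE// diff_comp ?c0//= -(deriveE (1 : R) diffc) => DE.
rewrite {1}/partial -/e -DE -deriveE// fE; apply: eq_bigr => j _.
by rewrite (@derive_val _ _ _ _ _ _ _ isF) mxE.
Qed.
End ChainRule.

(** By the chain rule a partial derivative of [f \o F] is a sum of products of a C^k function with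
    some [partial j f \o F], to which the induction hypothesis applies. The continuity statement
    [cfF] is generalized together with [f] for this purpose. *)
Lemma Ck_comp n m k (U : set 'rV[R]_n) (V : set 'rV[R]_m)
    (F : 'rV[R]_n -> 'rV[R]_m) (f : 'rV[R]_m -> R^o) :
  open U -> open V -> (forall x, U x -> V (F x)) ->
  (forall j, Ck k U (fun x => F x 0 j)) -> Ck k V f -> Ck k U (f \o F).
Proof.
move=> oU oV FUV.
have cF (j : nat) : (forall i, Ck j U (fun x => F x 0 i)) ->
    forall x, U x -> {for x, continuous F}.
  by move=> FC x Ux; apply: continuous_row => i; exact: Ck_continuous (FC i) Ux.
have cfF j : (forall i, Ck j U (fun x => F x 0 i)) -> Ck j V f ->
    forall x, U x -> {for x, continuous (f \o F)}.
  move=> FC fC x Ux; apply: continuous_comp; first exact: cF FC x Ux.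
  exact: Ck_continuous fC (FUV x Ux).
have CkL j l W (g : 'rV[R]_l -> R^o) : Ck j.+1 W g -> Ck 1 W g.
  by elim: j => // j IH /CkW.
elim: k f cfF => [|k IHk] f cfF Fk fk; first by split=> // x; exact: cfF Fk fk x.
split=> [x Ux|i]; first exact: cfF Fk fk x Ux.
have F1 j : Ck 1 U (fun x => F x 0 j) by apply: CkL (Fk j).
have cr x Ux := @chain_rule n m U V F f oV FUV F1 (CkL _ _ _ _ fk) x i Ux.
split=> [x /cr[]//|].
apply: (@Ck_eq _ _ _ _ (fun x => \sum_j partial i (fun y => F y 0 j) x * partial j f (F x))) => //.
  by move=> x /cr[].
apply: Ck_sum => // j; apply: (@CkM _ _ _ _ _ (partial j f \o F)) => //.
  by have [_ /(_ i)[]] := Fk j.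
have FkW l : Ck k U (fun x => F x 0 l) by apply: CkW.
have [_ /(_ j)[_ fjk]] := fk.
apply: IHk => // l Fl fl x Ux; apply: continuous_comp; first exact: cF Fl x Ux.
exact: Ck_continuous fl (FUV x Ux).
Qed.
End CkComposition.

(** * Hadamard's lemma by integration along rays *)

Section Hadamard.
Context {R : realType} {n : nat}.
Variables (U : set 'rV[R]_n) (p : 'rV[R]_n).
Implicit Types (h f : 'rV[R]_n -> R^o).
Local Notation mu := (@lebesgue_measure R).
Local Notation I := (`[(0 : R), 1]%classic).

Let ray (x : 'rV[R]_n) (s : R) := s *: (x - p) + p.

Hypothesis oU : open U.
Hypothesis starU : forall x s, U x -> I s -> U (ray x s).

Let ray_continuous x : continuous (ray x).
Proof.
move=> s; apply: (@continuousD _ _ _ (fun s : R => s *: (x - p)) (fun=> p)).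
  exact: scalel_continuous.
exact: cst_continuous.
Qed.

(** Compactness of [[0, 1]] makes the estimate uniform in [s]. Limits then pass under the integral
    by a constant bound on the integrand, without dominated convergence. *)
Let ray_uniform h x0 (e : R) : (forall x, U x -> {for x, continuous h}) ->
  U x0 -> 0 < e ->
  \forall w \near (0 : 'rV[R]_n), forall s, I s ->
    U (w + ray x0 s) /\ `|h (w + ray x0 s) - h (ray x0 s)| <= e.
Proof.
move=> hc Ux0 e0.
have /compact_near_coveringP := @segment_compact R 0 1.
move=> /(_ _ (nbhs (0 : 'rV[R]_n)) (fun w s =>
  U (w + ray x0 s) /\ `|h (w + ray x0 s) - h (ray x0 s)| <= e)); apply.
move=> s0 Is0; have Uy := starU Ux0 Is0.
have e2 : 0 < e / 2 by rewrite divr_gt0.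
have ny : \forall y \near ray x0 s0, U y /\ `|h (ray x0 s0) - h y| <= e / 2.
  apply: filterI; first exact: open_nbhs_nbhs.
  by have := hc _ Uy; rewrite /prop_for /continuous_at => /cvgrPdist_le/(_ _ e2).
have c2 : (fun z : R * 'rV[R]_n => z.2 + ray x0 z.1) @ (s0, 0 : 'rV[R]_n) --> 0 + ray x0 s0.
  apply: cvgD; first exact: cvg_snd.
  by apply: (cvg_comp (@fst R 'rV[R]_n) (ray x0) _ (@ray_continuous x0 s0)); exact: cvg_fst.
rewrite add0r in c2.
have c1 : (fun z : R * 'rV[R]_n => ray x0 z.1) @ (s0, 0 : 'rV[R]_n) --> ray x0 s0.
  by apply: (cvg_comp (@fst R 'rV[R]_n) (ray x0) _ (@ray_continuous x0 s0)); exact: cvg_fst.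
have n1 : nbhs (s0, 0 : 'rV[R]_n) [set z | U (ray x0 z.1) /\
  `|h (ray x0 s0) - h (ray x0 z.1)| <= e / 2] := c1 _ ny.
have n2 : nbhs (s0, 0 : 'rV[R]_n) [set z | U (z.2 + ray x0 z.1) /\
  `|h (ray x0 s0) - h (z.2 + ray x0 z.1)| <= e / 2] := c2 _ ny.
apply: filterS (filterI n1 n2) => -[s w] [[_ hz1] [Uz hz]] /=; split=> //.
rewrite [e]splitr; apply: le_trans (lerD hz hz1).
by rewrite [X in _ <= X + _]distrC; exact: ler_distD.
Qed.

(* The weight [s ^+ k] makes the family stable under partial derivatives. *)
Definition radial (k : nat) h (x : 'rV[R]_n) : R^o :=
  \int[mu]_(s in I) (s ^+ k * h (s *: (x - p) + p)).

Let mI : measurable (I : set (measurableTypeR R)). Proof. by []. Qed.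

Let integrableI (f : R -> R) : (forall s, I s -> {for s, continuous f}) ->
  mu.-integrable I (EFin \o f).
Proof.
move=> fc; apply: continuous_compact_integrable; first exact: segment_compact.
apply: continuous_in_subspaceT => s; rewrite inE; exact: fc.
Qed.

Let radial_integrand_continuous k h (s : R) (x : 'rV[R]_n) :
  {for ray x s, continuous h} ->
  {for s, continuous (fun s : R => s ^+ k * h (ray x s) : R)}.
Proof.
move=> hc; apply: (@continuousM _ _ (fun s : R => s ^+ k) (fun s => h (ray x s))).
  exact: exprn_continuous.
by apply: (@continuous_comp _ _ _ (ray x) h) => //; exact: ray_continuous.
Qed.

Let radial_integrable k h x : (forall x, U x -> {for x, continuous h}) ->
  U x -> mu.-integrable I (EFin \o (fun s => s ^+ k * h (ray x s))).
Proof.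
move=> hc Ux; apply: integrableI => s Is.
exact/radial_integrand_continuous/hc/starU.
Qed.

Let RintegralI_cst (e : R) : \int[mu]_(s in I) e = e.
Proof.
rewrite Rintegral_cst// -[RHS]mulr1; congr (_ * _).
have := @lebesgue_measure_itv R `[0, 1]; rewrite /= lte_fin ltr01 oppr0 adde0.
by move=> E; rewrite [X in fine X]E.
Qed.

Let Rintegral_le_cst (f : R -> R) (e : R) : mu.-integrable I (EFin \o f) ->
  (forall s, I s -> `|f s| <= e) -> `|\int[mu]_(s in I) f s| <= e.
Proof.
move=> fi fe; apply: le_trans (le_normr_Rintegral mI fi) _.
rewrite -(RintegralI_cst e).
apply: le_Rintegral => //.
  have := integrable_norm fi; exact.
apply: integrableI => s _; exact: cst_continuous.
Qed.

Let radial_continuous k h x : (forall x, U x -> {for x, continuous h}) ->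
  U x -> {for x, continuous (radial k h)}.
Proof.
move=> hc Ux; apply: (iffRL (@cvgrPdist_le _ R^o _ (nbhs x) _ (radial k h) (radial k h x))) => e e0.
have := ray_uniform hc Ux e0 => /nbhs_ballP[d /= d0 dP].
near=> y; have yx : `|y - x| < d.
  by near: y; apply/nbhs_ballP; exists d => // y; rewrite -ball_normE /= distrC.
have Uy : U y.
  have := dP (y - x); rewrite -ball_normE /= sub0r normrN => /(_ yx 1).
  rewrite /ray scale1r !subrK; case=> //=.
  by rewrite in_itv /= ler01 lexx.
rewrite /radial -RintegralB//; [|exact: radial_integrable..].
apply: Rintegral_le_cst.
  have := integrableB mI (radial_integrable k hc Ux) (radial_integrable k hc Uy).
  by apply.
move=> s Is; rewrite -mulrBr normrM -[e]mul1r; apply: ler_pM => //.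
  move: Is; rewrite /= in_itv /= => /andP[s0 s1].
  by rewrite normrX exprn_ile1// ger0_norm.
have := dP (s *: (y - x)); rewrite -ball_normE /= sub0r normrN => /(_ _ s Is).
have -> : s *: (y - x) + ray x s = ray y s.
  by rewrite /ray addrA -scalerDr addrA subrK.
rewrite distrC => H; apply: (H _).2.
move: Is; rewrite /= in_itv /= => /andP[s0 s1].
by rewrite normrZ; apply: le_lt_trans yx; rewrite ler_piMl// ger0_norm.
Unshelve. all: by end_near. Qed.

Let norm_line (t : R) (i : 'I_n) : `|t *: delta_mx 0 i : 'rV[R]_n| <= `|t|.
Proof.
rewrite row_norm_le//; apply/forallP => j; rewrite !mxE eqxx /=.
by case: (j == i); rewrite ?mulr1 ?mulr0 ?normr0.
Qed.

(** Differentiation under the integral. Moving [x] by [t] moves the ray at time [s] by [s * t], so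
    the mean value theorem yields [s] times a nearby partial derivative. This factor raises the
    weight from [k] to [k + 1], and [ray_uniform] controls the error. *)
Lemma is_derive_radial k h x i : Ck 1 U h -> U x ->
  is_derive x (delta_mx 0 i : 'rV[R]_n) (radial k h) (radial k.+1 (partial i h) x).
Proof.
move=> [hc hd] Ux; have {hd}[hd [hic _]] := hd i; pose e : 'rV[R]_n := delta_mx 0 i.
suff C : (fun t : R => t^-1 *: ((radial k h \o shift x) (t *: e) - radial k h x))
    @ (0 : R)^' --> radial k.+1 (partial i h) x.
  by apply: DeriveDef; [exact: (cvgP _ C)|exact: (cvg_lim _ C)].
apply: (iffRL (@cvgrPdist_le _ R^o _ _ _ _ _)) => eps eps0.
have := ray_uniform hic Ux eps0 => /nbhs_ballP[d /= d0 dP].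
have {}dP (c s : R) : `|c| < d -> I s ->
    U (c *: e + ray x s) /\ `|partial i h (c *: e + ray x s) - partial i h (ray x s)| <= eps.
  move=> cd; apply: dP; rewrite -ball_normE /= sub0r normrN.
  exact: le_lt_trans (norm_line _ _) cd.
have I1 : I 1 by rewrite /= in_itv /= ler01 lexx.
near=> t; have t0 : t != 0 by near: t; exact: nbhs_dnbhs_neq.
have td : `|t| < d by near: t; exact: dnbhs0_lt.
have Ut : U (t *: e + x) by have [] := dP t 1 td I1; rewrite /ray scale1r subrK.
have i1 := @radial_integrable k.+1 _ _ hic Ux.
have i2 := @radial_integrable k _ _ hc Ut.
have i3 := @radial_integrable k _ _ hc Ux.
pose u s := s ^+ k * h (ray (t *: e + x) s) - s ^+ k * h (ray x s).
have iu : mu.-integrable I (EFin \o u) := integrableB mI i2 i3.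
have itu : mu.-integrable I (EFin \o (fun s => t^-1 * u s)) := integrableZl mI t^-1 iu.
have -> : radial k.+1 (partial i h) x - t^-1 *: ((radial k h \o shift x) (t *: e) - radial k h x)
  = \int[mu]_(s in I) (s ^+ k.+1 * partial i h (ray x s) - t^-1 * u s).
  rewrite (RintegralB mI i1 itu) (RintegralZl t^-1 mI iu).
  by rewrite /u (RintegralB mI i2 i3).
have iw : mu.-integrable I (EFin \o (fun s => s ^+ k.+1 * partial i h (ray x s) - t^-1 * u s)).
  exact: (integrableB mI i1 itu).
apply: (Rintegral_le_cst iw).
move=> s Is; have /andP[s0 s1] : 0 <= s <= 1 by move: Is; rewrite /= in_itv.
have std (c : R) : `|c| <= `|s * t| -> `|c| < d.
  move=> /le_lt_trans; apply; apply: le_lt_trans td.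
  by rewrite normrM ler_piMl// ger0_norm.
rewrite /u; have -> : ray (t *: e + x) s = (s * t) *: e + ray x s.
  by rewrite /ray addrA -scalerA -scalerDr addrA.
have [c ct hE] := @MVT_line _ _ h (ray x s) e (s * t)
  (fun c ct => hd _ (dP c s (std c ct) Is).1).
rewrite -mulrBr hE -/(partial i h _).
have -> : s ^+ k.+1 * partial i h (ray x s)
    - t^-1 * (s ^+ k * (s * t * partial i h (c *: e + ray x s)))
  = s ^+ k.+1 * (partial i h (ray x s) - partial i h (c *: e + ray x s)).
  by rewrite exprS; field.
rewrite normrM -[eps]mul1r distrC; apply: ler_pM => //.
  by rewrite normrX exprn_ile1// ger0_norm.
by have [] := dP c s (std c ct) Is.
Unshelve. all: by end_near. Qed.

Lemma radial_smooth k h : smooth_on U h -> smooth_on U (radial k h).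
Proof.
move=> hs K; elim: K k h hs => [|K IHK] k h hs.
  by split=> // x Ux; apply: radial_continuous => // y; have [hc _] := hs 0; exact: hc.
split=> [x Ux|i].
  by apply: radial_continuous => // y; have [hc _] := hs 0; exact: hc.
have dE x Ux := is_derive_radial k i (hs 1) (x := x) Ux.
split=> [x /dE[]//|].
apply: (@Ck_eq _ _ _ _ (radial k.+1 (partial i h))) => //.
  by move=> x /dE[_ dE']; rewrite /partial dE'.
by apply: IHK => j; have [_ /(_ i)[]] := hs j.+1.
Qed.

Lemma radial0_center h : radial 0 h p = h p.
Proof.
rewrite -[RHS]RintegralI_cst /radial; apply: eq_Rintegral => s _.
by rewrite expr0 mul1r subrr scaler0 add0r.
Qed.

(** Integrability is carried through the induction because additivity of the integral requires it of
    the partial sums. *)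
Let Rintegral_lin (J : Type) (r : seq J) (c : J -> R) (u : J -> R -> R) :
  (forall j, mu.-integrable I (EFin \o u j)) ->
  mu.-integrable I (EFin \o (fun s => \sum_(j <- r) c j * u j s)) /\
  \int[mu]_(s in I) (\sum_(j <- r) c j * u j s)
    = \sum_(j <- r) c j * \int[mu]_(s in I) u j s.
Proof.
move=> ui; elim: r => [|j r [IHi IHE]].
  have -> : (fun s => \sum_(j <- [::]) c j * u j s) = (fun=> 0).
    by apply/funext => s; rewrite big_nil.
  split; last by rewrite big_nil RintegralI_cst.
  by apply: integrableI => s _; exact: cst_continuous.
have -> : (fun s => \sum_(l <- j :: r) c l * u l s)
    = (fun s => c j * u j s + \sum_(l <- r) c l * u l s).
  by apply/funext => s; rewrite big_cons.
have cui : mu.-integrable I (EFin \o (fun s => c j * u j s)) := integrableZl mI (c j) (ui j).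
split; first exact: (integrableD mI cui IHi).
by rewrite (RintegralD mI cui IHi) IHE big_cons (RintegralZl (c j) mI (ui j)).
Qed.

Lemma hadamard f x : smooth_on U f -> U x ->
  f x - f p = \sum_i (x 0 i - p 0 i) * radial 0 (partial i f) x.
Proof.
move=> fs Ux; pose g (s : R) : R^o := f (ray x s).
pose dg (s : R) : R^o := \sum_i (x 0 i - p 0 i) * partial i f (ray x s).
have pc i y : U y -> {for y, continuous (partial i f)}.
  by have [_ /(_ i)[_ [pc _]]] := fs 1; exact: pc.
have g_derive s : I s -> is_derive s 1 g (dg s).
  move=> Is; have [df dE] := C1_differentiable oU (fs 1) (starU Ux Is).
  have := @is_derive_line _ _ f p (x - p) s (@diff_derivable _ _ _ _ _ _ df).
  rewrite dE; under eq_bigr do rewrite !mxE.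
  by [].
have cdg s : I s -> {for s, continuous dg}.
  move=> Is; have -> : dg = \sum_i (fun s => (x 0 i - p 0 i) * partial i f (ray x s)) :> (R -> R^o).
    by apply/funext => t; rewrite fct_sumE.
  apply: (big_ind (fun u : R -> R^o => {for s, continuous u})) => [|u v uc vc|i _].
  - exact: cst_continuous.
  - exact: continuousD.
  apply: (@continuousM _ _ (fun=> x 0 i - p 0 i) (partial i f \o ray x)).
    exact: cst_continuous.
  by apply: continuous_comp; [exact: ray_continuous|exact/pc/starU].
have cg (s : R) : I s -> {for s, continuous g}.
  by move=> /g_derive[/derivable1_diffP ? _]; exact: differentiable_continuous.
have I0 : I 0 by rewrite /= in_itv /= ler01 lexx.
have I1 : I 1 by rewrite /= in_itv /= ler01 lexx.
have FTC : (\int[mu]_(s in I) (dg s)%:E = (g 1)%:E - (g 0)%:E)%E.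
  apply: continuous_FTC2 => //.
  - by apply: continuous_in_subspaceT => s; rewrite inE; exact: cdg.
  - split.
    + by move=> s /subset_itv_oo_cc/g_derive[].
    + exact: (cvg_at_right_filter (cg _ I0)).
    + exact: (cvg_at_left_filter (cg _ I1)).
  - by move=> s /subset_itv_oo_cc/g_derive[_ <-]; rewrite derive1E.
have -> : f x - f p = \int[mu]_(s in I) dg s.
  by rewrite /Rintegral FTC /= /g /ray scale1r scale0r subrK add0r.
pose u i (s : R) := s ^+ 0 * partial i f (ray x s).
have ui i : mu.-integrable I (EFin \o u i) by apply: radial_integrable => // y; exact: pc.
transitivity (\int[mu]_(s in I) \sum_i ((x 0 i - p 0 i) * u i s)).
  by apply: eq_Rintegral => s _; apply: eq_bigr => i _; rewrite /u expr0 mul1r.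
by have [_ ->] := Rintegral_lin (index_enum 'I_n) (fun i => x 0 i - p 0 i) ui.
Qed.
End Hadamard.

(** * Flat functions and smooth steps *)

Section FlatFunction.
Context {R : realType}.

(** The classical flat function exp(-1/t), divided by t^m so that the family is closed under
    differentiation up to linear combinations. *)
Definition flat (m : nat) (t : R) : R^o := if 0 < t then t^-1 ^+ m * expR (- t^-1) else 0.

Lemma flat_gt0 m t : 0 < t -> 0 < flat m t.
Proof. by move=> t0; rewrite /flat t0 mulr_gt0 ?exprn_gt0 ?invr_gt0 ?expR_gt0. Qed.

Lemma flat_le0 m t : t <= 0 -> flat m t = 0.
Proof. by move=> t0; rewrite /flat ltNge t0. Qed.

(** With [y = 1/t], raising [y/(m+1) <= exp(y/(m+1))] to the power [m + 1] gives the constant; the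
    power is one more than [m], and the surplus factor [y] becomes [t]. *)
Lemma flat_le_linear m t : 0 < t -> `|flat m t| <= (m.+1)%:R ^+ m.+1 * t.
Proof.
move=> t0; rewrite gtr0_norm ?flat_gt0// /flat t0; set y := t^-1.
have y0 : 0 < y by rewrite invr_gt0.
have expy : y ^+ m.+1 <= (m.+1)%:R ^+ m.+1 * expR y.
  have -> : y = (m.+1)%:R * (y / (m.+1)%:R) by rewrite mulrC divfK.
  rewrite exprMn expRM_natl ler_wpM2l ?exprn_ge0// lerXn2r ?nnegrE ?expR_ge0 ?divr_ge0 ?ltW//.
  by apply: lt_le_trans (expR_ge1Dx _); rewrite ltrDr.
rewrite expRN ler_pdivrMr ?expR_gt0//.
have -> : t = y^-1 by rewrite invrK.
by rewrite mulrAC ler_pdivlMr// -exprSr.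
Qed.

(** Away from 0 this is the product rule. At 0 the right difference quotient of [flat m] is
    [flat m.+1], which tends to 0 by [flat_le_linear]. *)
Lemma is_derive_flat m (t : R) :
  is_derive t 1 (flat m) (flat m.+2 t - m%:R * flat m.+1 t).
Proof.
have [t0|t0|->] := ltgtP t 0.
- rewrite !flat_le0 ?ltW// mulr0 subr0.
  apply: (near_eq_is_derive (f := fun=> 0)) => //.
  by near=> s; rewrite /flat ltNge ltW//; near: s; exact: lt_nbhsl.
- have tn0 : t != 0 by rewrite gt_eqF.
  apply: (near_eq_is_derive (f := fun s : R => s^-1 ^+ m * expR (- s^-1))).
    by near=> s; rewrite /flat ifT//; near: s; exact: lt_nbhsr.
  have dV : is_derive t 1 (fun s : R => s^-1) (- t ^- 2 *: 1) by exact: is_deriveV.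
  have dE : is_derive t 1 (fun s : R => expR (- s^-1)) (expR (- t^-1) * (- (- t ^- 2 *: 1))).
    by apply: (@is_derive1_comp R expR (fun s : R => - s^-1)).
  case: m => [|m].
    have -> : (fun s : R => s^-1 ^+ 0 * expR (- s^-1)) = (fun s => expR (- s^-1)).
      by apply/funext => s; rewrite expr0 mul1r.
    apply: (is_derive_eq dE); rewrite /flat t0 mul0r subr0 mulrC [_ *: 1]mulr1 opprK.
    by rewrite exprVn.
  have dM := is_deriveM (is_deriveX m.+1 dV) dE.
  have <- : ((fun s : R => s^-1) ^+ m.+1 * (fun s => expR (- s^-1)))
      = (fun s : R => s^-1 ^+ m.+1 * expR (- s^-1)).
    by apply/funext => s; rewrite !fctE.
  apply: (is_derive_eq dM); rewrite /flat t0 exprfctE /= -!exprVn !exprS /GRing.scale /=.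
  by ring.
- rewrite !flat_le0// mulr0 subr0.
  suff C : (fun h : R => h^-1 *: ((flat m \o shift 0) (h *: 1) - flat m 0)) @ 0^' --> 0.
    by apply: DeriveDef; [exact: (cvgP _ C)|exact: (cvg_lim _ C)].
  apply: (iffRL (@cvgrPdist_le _ R^o _ _ _ _ _)) => e e0.
  (* The constant of [flat_le_linear] for [m.+1], the index reached after dividing by [h]. *)
  pose C : R := (m.+2)%:R ^+ m.+2; have C0 : 0 < C by rewrite exprn_gt0.
  near=> h; rewrite sub0r normrN /= (flat_le0 m (lexx 0)) subr0 addr0.
  rewrite [h *: 1]mulr1; have [h0|h0] := leP h 0.
    by rewrite flat_le0// scaler0 normr0 ltW.
  have -> : h^-1 *: flat m h = flat m.+1 h.
    by rewrite /flat h0 [_ *: _]mulrA -exprS.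
  apply: le_trans (flat_le_linear _ h0) _; rewrite -/C mulrC -ler_pdivlMr//.
  apply: le_trans (ler_norm _) _; apply: ltW; near: h; apply: dnbhs0_lt.
  by rewrite divr_gt0.
Unshelve. all: by end_near. Qed.

(** Here [f] has a derivative in the single direction [v], so it is restricted to that line, where
    the one-variable chain rule applies. *)
Lemma is_derive_comp1 (V : normedModType R) (g : R -> R^o) (f : V -> R^o)
    (x v : V) (df dg : R) :
  is_derive x v f df -> is_derive (f x) 1 g dg -> is_derive x v (g \o f) (dg * df).
Proof.
move=> [fd fE] gd; pose c (h : R) : R^o := f (h *: v + x).
have cd : is_derive (0 : R) 1 c df.
  by have := @is_derive_line _ _ f x v 0; rewrite scale0r add0r fE; apply.
have c0 : c 0 = f x by rewrite /c scale0r add0r.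
have [gcd gcE] : is_derive (0 : R) 1 (g \o c) (dg * df).
  by apply: is_derive1_comp; rewrite c0.
have gfd : derivable (g \o f) x v by exact: (iffRL (derivable1P (g \o f : V -> R^o) x v) gcd).
apply: DeriveDef => //; rewrite -gcE.
by have := @is_derive_line _ _ (g \o f : V -> R^o) x v 0; rewrite scale0r add0r => /(_ gfd)[_ <-].
Qed.

(** The induction on [k] runs for all [m] at once, since a derivative of [flat m] involves
    [flat m.+1] and [flat m.+2]. *)
Lemma Ck_flat n m k (U : set 'rV[R]_n) f : open U -> Ck k U f -> Ck k U (flat m \o f).
Proof.
move=> oU; elim: k m f => [|k IHk] m f fk.
  split=> // x Ux; apply: continuous_comp; first by case: fk => fc _; exact: fc.
  by apply: differentiable_continuous; apply/derivable1_diffP; case: (is_derive_flat m (f x)).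
have fk' := CkW fk; have [fc fd] := fk.
have cont x : U x -> {for x, continuous (flat m \o f)}.
  move=> Ux; apply: continuous_comp; first exact: fc.
  by apply: differentiable_continuous; apply/derivable1_diffP; case: (is_derive_flat m (f x)).
split=> // i; have [fdi fki] := fd i.
have dE x : U x -> is_derive x (delta_mx 0 i : 'rV[R]_n) (flat m \o f)
    ((flat m.+2 (f x) - m%:R * flat m.+1 (f x)) * partial i f x).
  move=> Ux; apply: is_derive_comp1; last exact: is_derive_flat.
  by apply: DeriveDef => //; exact: fdi.
split=> [x /dE[]//|].
apply: (@Ck_eq _ _ _ _
  ((flat m.+2 \o f \+ (fun=> - m%:R) \* (flat m.+1 \o f)) \* partial i f)) => //.
  by move=> x /dE[_ dE']; rewrite /partial dE' /= mulNr.
apply: CkM => //; apply: CkD => //; first exact: IHk.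
apply: CkM => //; [exact: Ck_cst|exact: IHk].
Qed.

(* The outer [flat 0] is applied to a quantity that is nonpositive for [t <= 0]
   and constant for [1 <= t]; no quotient of smooth functions is needed. *)
Definition smooth_step (t : R) : R^o := flat 0 (flat 0 1 - flat 0 (1 - t)) / flat 0 (flat 0 1).

Lemma smooth_step_le0 t : t <= 0 -> smooth_step t = 0.
Proof.
move=> t0; rewrite /smooth_step flat_le0 ?mul0r// subr_le0.
have t1 : 0 < 1 - t by lra.
rewrite /flat ltr01 t1 !expr0 !mul1r ler_expR lerN2 lef_pV2 ?posrE//.
by lra.
Qed.

Lemma smooth_step_ge1 t : 1 <= t -> smooth_step t = 1.
Proof.
move=> t1; rewrite /smooth_step [flat 0 (1 - t)]flat_le0 ?subr_le0// subr0 divff//.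
by rewrite gt_eqF// flat_gt0// flat_gt0.
Qed.

Lemma Ck_smooth_step n k (U : set 'rV[R]_n) f : open U -> Ck k U f -> Ck k U (smooth_step \o f).
Proof.
move=> oU fk; apply: (@CkM _ _ _ _ _ (fun=> (flat 0 (flat 0 1))^-1)) => //; last first.
  exact: Ck_cst.
have CkN g : Ck k U g -> Ck k U (fun x => - g x).
  move=> gk; have := CkM oU (@Ck_cst R n k U (-1)) gk.
  by apply: Ck_eq => // x _ /=; rewrite mulN1r.
apply: (@Ck_flat _ 0 _ _ (fun x => flat 0 1 - flat 0 (1 - f x))) => //.
apply: (@CkD _ _ _ _ (fun=> flat 0 1)) => //; first exact: Ck_cst.
apply: (CkN); apply: (@Ck_flat _ 0 _ _ (fun x => 1 - f x)) => //.
apply: (@CkD _ _ _ _ (fun=> 1)) => //; first exact: Ck_cst.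
exact: CkN.
Qed.
End FlatFunction.

(** * Smooth functions and tangent vectors on manifolds *)

Section SmoothFunctionTheory.
Context {R : realType} {n : nat} {M : manifold R n}.
Implicit Types (W V : set M) (f g : M -> R^o).

Lemma smooth_partial m (U : set 'rV[R]_m) (f : 'rV[R]_m -> R^o) i :
  smooth_on U f -> smooth_on U (partial i f).
Proof. by move=> fs k; have [_ /(_ i)[]] := fs k.+1. Qed.

(** Smoothness is defined by all charts of the atlas; since transition maps are smooth, [Ck_comp]
    transfers it from one chart around each point to all of them. *)
Lemma smooth_fun_local W f :
  (forall p, W p -> exists c V, [/\ atlas c, open V, V p, cdom c p &
     smooth_on (cmap c @` (cdom c `&` V)) (f \o cinv c)]) ->
  smooth_fun W f.
Proof.
move=> loc d Ad k; apply: Ck_local => _ [p [dp Wp] <-].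
have [c [V [Ac oV Vp cp fcs]]] := loc p Wp.
have oVc : open (V `&` cdom c) by apply: openI => //; exact: open_cdom.
pose N := cmap d @` (cdom d `&` (V `&` cdom c)); have oN : open N by exact: open_cimgI.
exists N; first by exists p.
apply: (@Ck_eq _ _ _ _ ((f \o cinv c) \o (fun x => cmap c (cinv d x)))) => //.
  by move=> _ [q [dq [_ cq]] <-] /=; rewrite !cmapK.
apply: (@Ck_comp _ _ _ k N _ (fun x => cmap c (cinv d x)) (f \o cinv c) oN
  (open_cimgI (c := c) oV)) => [_ [q [dq [Vq cq]] <-]|i|//].
  by rewrite cmapK//; exists q.
by apply: CkS (atlas_smooth Ad Ac i k) => _ [q [dq [Vq cq]] <-]; exists q.
Qed.

Lemma smooth_fun_cover W f :
  (forall p, W p -> exists V, [/\ open V, V p & smooth_fun V f]) -> smooth_fun W f.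
Proof.
move=> loc; apply: smooth_fun_local => p /loc[V [oV Vp fs]].
by have [c Ac cp] := atlas_cover p; exists c, V; split=> //; exact: fs.
Qed.

Lemma smooth_fun_eq W f g : open W -> (forall p, W p -> f p = g p) ->
  smooth_fun W f -> smooth_fun W g.
Proof.
move=> oW fg fs c Ac k; apply: Ck_eq (fs c Ac k); first exact: open_cimgI.
by move=> _ [p [cp Wp] <-] /=; rewrite cmapK// fg.
Qed.

Lemma smooth_fun_chart (c : chart R n M) (g : 'rV[R]_n -> R^o) : atlas c ->
  smooth_on (cmap c @` cdom c) g -> smooth_fun (M := M) (cdom c) (g \o cmap c).
Proof.
move=> Ac gs; apply: smooth_fun_local => p cp.
exists c, (cdom c); split=> //; first exact: open_cdom.
rewrite setIid => k; apply: Ck_eq (gs k); first exact: open_cimg.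
by move=> _ [q cq <-] /=; rewrite cmapK.
Qed.

Lemma smooth_fun_coord (c : chart R n M) i :
  atlas c -> smooth_fun (M := M) (cdom c) (fun p => cmap c p 0 i).
Proof. by move=> Ac; apply: (@smooth_fun_chart c (fun x => x 0 i)) => // k; exact: Ck_coord. Qed.

Lemma smooth_fun_comp (phi : smooth_map M M) W f : open W -> smooth_fun W f ->
  smooth_fun (phi @^-1` W) (f \o phi).
Proof.
move=> oW fs; apply: smooth_fun_local => p Wp.
have [c Ac cp] := atlas_cover p; have [d Ad dp] := atlas_cover (phi p).
have oV : open (cdom d `&` W) by apply: openI => //; exact: open_cdom.
have oV' := @open_preimage_smap _ _ _ phi _ oV.
exists c, (phi @^-1` (cdom d `&` W)); split=> // k.
apply: (@Ck_eq _ _ _ _ ((f \o cinv d) \o (fun x => cmap d (phi (cinv c x))))).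
- exact: open_cimgI.
- by move=> _ [q [cq [dq Wq]] <-] /=; rewrite !cmapK.
apply: (@Ck_comp _ _ _ k _ _ (fun x => cmap d (phi (cinv c x))) (f \o cinv d)
  (open_cimgI (c := c) oV') (open_cimgI (c := d) oW)) (fs d Ad k).
  by move=> _ [q [cq [dq Wq]] <-]; rewrite !cmapK//; exists (phi q).
move=> i; apply: CkS (smap_smooth phi Ac Ad i k) => _ [q [cq [dq Wq]] <-].
by exists q.
Qed.

Lemma smooth_fun_sum W (I : Type) (r : seq I) (f : I -> M -> R^o) : open W ->
  (forall i, smooth_fun W (f i)) -> smooth_fun W (fun p => \sum_(i <- r) f i p).
Proof.
move=> oW fs c Ac k; apply: (@Ck_sum _ _ k _ _ r (fun i => f i \o cinv c)).
  exact: open_cimgI.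
by move=> i; exact: fs.
Qed.

Lemma cinf_smooth (f : cinf M) W : smooth_fun W f.
Proof. by have /asboolP := valP f; exact: smooth_funS. Qed.

Lemma to_cinfE f : smooth_fun setT f -> to_cinf f = f :> (M -> R^o).
Proof. by move=> fs; rewrite /to_cinf insubdK//; apply/asboolP. Qed.

(** The open sets [O] and [W] cover [M] and [chi] vanishes on [O]. Hence [chi] times a function
    smooth on [W], extended by zero, is smooth by [smooth_fun_cover]. *)
Lemma bump_exists p W : open W -> W p -> exists (chi : cinf M) (O : set M),
  [/\ \forall q \near p, chi q = 1, open O, forall q, O q \/ W q &
      forall q, O q -> chi q = 0].
Proof.
move=> oW Wp; have [c Ac cp] := atlas_cover p.
have oU := open_cimgI (c := c) oW; set U := cmap c @` _ in oU.
pose a := cmap c p; have Ua : U a by exists p.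
have /nbhs_ballP[r' /= r'0 rU] : nbhs a U by apply: open_nbhs_nbhs.
pose r := r' / 2; have r0 : 0 < r by rewrite divr_gt0.
(* The norm on row vectors is the maximum norm, which is not smooth; the sum of squares replaces it
   in the bump function. *)
pose N (x : 'rV[R]_n) : R^o := \sum_i (x 0 i - a 0 i) ^+ 2.
have Ns k (V : set 'rV[R]_n) : open V -> Ck k V N.
  move=> oV; apply: Ck_sum => // i.
  have C : Ck k V (fun x : 'rV[R]_n => x 0 i - a 0 i).
    apply: (@CkD _ _ _ _ (fun x : 'rV[R]_n => x 0 i) (fun=> - a 0 i)) => //.
      exact: Ck_coord.
    exact: Ck_cst.
  exact: (CkM oV C C).
(* The argument of the step is at least 1 when [N x <= r^2 / 2] and at most 0 when [N x >= r^2]; the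
   latter holds outside [K], where some coordinate differs from that of [a] by more than [r]. *)
pose b (x : 'rV[R]_n) : R^o := smooth_step (2 - 2 / r ^+ 2 * N x).
have bs (V : set 'rV[R]_n) : open V -> smooth_on V b.
  move=> oV k; apply: (@Ck_smooth_step _ _ _ _ (fun x => 2 - 2 / r ^+ 2 * N x)) => //.
  apply: (@CkD _ _ _ _ (fun=> 2)) => //; first exact: Ck_cst.
  have := CkM oV (@Ck_cst R n k V (- (2 / r ^+ 2))) (Ns k V oV).
  by apply: Ck_eq => // x _ /=; rewrite mulNr.
pose K : set 'rV[R]_n := [set x | `|x - a| <= r].
have bK x : ~ K x -> b x = 0.
  move=> /negP; rewrite row_norm_le ?ltW// negb_forall => /existsP[i].
  rewrite !mxE -ltNge => ri; apply: smooth_step_le0; rewrite subr_le0.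
  have rN : r ^+ 2 <= N x.
    rewrite /N (bigD1 i)//= -[r ^+ 2]addr0; apply: lerD.
      by rewrite -[leRHS]real_normK ?num_real// lerXn2r ?nnegrE// ltW.
    by apply: sumr_ge0 => j _; exact: sqr_ge0.
  by rewrite mulrAC ler_pdivlMr ?exprn_gt0// ler_wpM2l.
have KU x : K x -> U x.
  move=> Kx; apply: rU; rewrite -ball_normE /= distrC; apply: le_lt_trans Kx _.
  by rewrite /r ltr_pdivrMr// ltr_pMr// ltr1n.
have cK : compact (cinv c @` K).
  apply: continuous_compact.
    apply: continuous_in_subspaceT => x; rewrite inE => /KU[q [cq _] <-].
    by apply: cinv_continuous; exists q.
  apply: bounded_closed_compact.
    exists (`|a| + r); split; first by rewrite num_real.
    move=> t tr x Kx; apply: ltW; apply: le_lt_trans tr.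
    by rewrite -[x](subrK a) addrC (le_trans (ler_normD _ _))// lerD2l.
  have -> : K = closed_ball a r
    by rewrite closed_ballE// /closed_ball_; apply/funext => x; rewrite /K /= distrC.
  exact: closed_ball_closed.
(* The Hausdorff property makes this compact set closed in all of [M], not just in the chart domain;
   so extension by zero is smooth at the boundary of the chart. *)
have clK : closed (cinv c @` K) by apply: compact_closed cK; exact: mfd_hausdorff.
pose O := ~` (cinv c @` K); have oO : open O by rewrite openC.
pose chi0 (q : M) : R^o := if pselect (cdom c q) then b (cmap c q) else 0.
have chiO q : O q -> chi0 q = 0.
  rewrite /chi0; case: pselect => // cq Oq; apply: bK => Kq; apply: Oq.
  by exists (cmap c q) => //; rewrite cmapK.
have OW q : O q \/ (W q /\ cdom c q).
  have [[x /KU[q' [cq' Wq'] <-] <-]|nK] := pselect ((cinv c @` K) q); last by left.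
  by right; rewrite cmapK.
have chis : smooth_fun setT chi0.
  apply: smooth_fun_cover => q _; have [Oq|[_ cq]] := OW q.
    exists O; split=> //; apply: smooth_fun_eq (smooth_fun_cst _ 0) => //.
    by move=> q' /chiO.
  exists (cdom c); split=> //; first exact: open_cdom.
  apply: (@smooth_fun_eq _ (b \o cmap c)); first exact: open_cdom.
    by move=> q' cq'; rewrite /chi0; case: pselect.
  by apply: smooth_fun_chart => //; apply: bs; exact: open_cimg.
exists (to_cinf chi0), O; rewrite to_cinfE//; split=> //; last first.
  by move=> q; case: (OW q) => [|[]]; [left|right].
have cN : {for a, continuous N} by have [] := Ns 0 setT openT => Nc _; exact: Nc.
have Na : N a = 0 by rewrite /N big1// => i _; rewrite subrr expr0n.
have nN : \forall x \near a, N x < r ^+ 2 / 2.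
  have nNa : \forall y \near (N a : R), y < r ^+ 2 / 2.
    by apply: lt_nbhsl; rewrite Na divr_gt0// exprn_gt0.
  exact: (cN _ nNa).
have nN' := @cmap_continuous _ _ _ c p cp _ nN.
have nc : nbhs p (cdom c) by apply: open_nbhs_nbhs; split => //; exact: open_cdom.
apply: filterS (filterI nc nN') => q [cq Nq].
have -> : chi0 q = b (cmap c q) by rewrite /chi0; case: (pselect (cdom c q)).
apply: smooth_step_ge1; have : 2 / r ^+ 2 * N (cmap c q) <= 1.
  rewrite mulrAC ler_pdivrMr ?exprn_gt0// mul1r mulrC -ler_pdivlMr//.
  exact: ltW.
by move=> ?; lra.
Qed.

Lemma cinf_extend p W f : open W -> W p -> smooth_fun W f ->
  exists g : cinf M, \forall q \near p, g q = f q.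
Proof.
move=> oW Wp fs; have [chi [Z [chi1 oZ ZW chi0]]] := bump_exists oW Wp.
have gs : smooth_fun setT (chi \* f).
  apply: smooth_fun_cover => q _; have [Zq|Wq] := ZW q.
    exists Z; split=> //; apply: smooth_fun_eq (smooth_fun_cst _ 0) => //.
    by move=> q' /chi0 /= ->; rewrite mul0r.
  by exists W; split=> //; apply: smooth_funM => //; exact: cinf_smooth.
exists (to_cinf (chi \* f)); rewrite to_cinfE//.
by apply: filterS chi1 => q /= ->; rewrite mul1r.
Qed.

End SmoothFunctionTheory.

Section CinfTheory.
Context {R : realType} {n : nat} {M : manifold R n}.
Implicit Types (f g : cinf M) (p : M).

Lemma cinfP f g : (forall p, f p = g p) -> f = g.
Proof. by move=> fg; apply: val_inj; apply/funext. Qed.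

Lemma cinf0 p : (0 : cinf M) p = 0. Proof. by []. Qed.
Lemma cinf1 p : (1 : cinf M) p = 1. Proof. by []. Qed.
Lemma cinfD f g p : (f + g : cinf M) p = f p + g p. Proof. by []. Qed.
Lemma cinfN f p : (- f : cinf M) p = - f p. Proof. by []. Qed.
Lemma cinfM f g p : (f * g : cinf M) p = f p * g p. Proof. by []. Qed.
Lemma cinfZ a f p : (a *: f : cinf M) p = a * f p. Proof. by []. Qed.
Lemma cinf_sum (I : Type) (r : seq I) (P : pred I) (F : I -> cinf M) p :
  (\sum_(i <- r | P i) F i : cinf M) p = \sum_(i <- r | P i) F i p.
Proof. by elim/big_rec2 : _ => // i y1 y2 _ <-. Qed.

Definition cinfE := (cinf0, cinf1, cinfD, cinfN, cinfM, cinfZ, cinf_sum).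

Lemma cinf_scaleE a f : a *: f = (a *: (1 : cinf M)) * f.
Proof. by apply: cinfP => p; rewrite !cinfE mulr1. Qed.

(* A global function with the germ of [f] at [p]; it is the junk value 0 when
   [f] is not smooth near [p]. *)
Definition germ_ext p (f : M -> R^o) : cinf M :=
  xget 0 [set g : cinf M | \forall q \near p, g q = f q].

Lemma germ_extE p (W : set M) (f : M -> R^o) : open W -> W p -> smooth_fun W f ->
  \forall q \near p, germ_ext p f q = f q.
Proof.
move=> oW Wp fs; have [g gP] := cinf_extend oW Wp fs.
by rewrite /germ_ext; case: xgetP => [h _ //|/(_ g)].
Qed.

Lemma open_chart_preimage (c : chart R n M) (B : set 'rV[R]_n) : open B ->
  open (cdom c `&` cmap c @^-1` B).
Proof.
move=> oB; rewrite openE => p [cp Bp]; apply: filterI.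
  by apply: open_nbhs_nbhs; split=> //; exact: open_cdom.
by apply: (cmap_continuous cp); apply: open_nbhs_nbhs.
Qed.

Lemma smooth_fun_chart_on (c : chart R n M) (B : set 'rV[R]_n) (g : 'rV[R]_n -> R^o) :
  atlas c -> open B -> smooth_on B g ->
  smooth_fun (M := M) (cdom c `&` cmap c @^-1` B) (g \o cmap c).
Proof.
move=> Ac oB gs; have oW := @open_chart_preimage c B oB.
apply: smooth_fun_local => p [cp Bp]; exists c, (cdom c `&` cmap c @^-1` B); split=> // k.
have sub : cmap c @` (cdom c `&` (cdom c `&` cmap c @^-1` B)) `<=` B.
  by move=> _ [q [_ [_ Bq]] <-].
apply: Ck_eq (CkS sub (gs k)); first exact: open_cimgI.
by move=> _ [q [cq _] <-] /=; rewrite cmapK.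
Qed.

End CinfTheory.

(** * Locality of derivations and tangent vectors in coordinates *)

Section TangentTheory.
Context {R : realType} {n : nat} {M : manifold R n} (p : M).
Implicit Types (v w : tangent p) (f g : cinf M).

Lemma tangentL v (a : R) f g : v (a *: f + g) = a * v f + v g.
Proof. by have /asboolP[vL _] := valP v; exact: vL. Qed.

Lemma tangentM v f g : v (f * g) = v f * g p + f p * v g.
Proof. by have /asboolP[_ vM] := valP v; exact: vM. Qed.

Lemma tangentD v f g : v (f + g) = v f + v g.
Proof. by rewrite -[f]scale1r tangentL mul1r scale1r. Qed.

Lemma tangent0 v : v 0 = 0.
Proof. by apply: (addrI (v 0)); rewrite -tangentD !addr0. Qed.

Lemma tangentZ v (a : R) f : v (a *: f) = a * v f.
Proof. by rewrite -[a *: f]addr0 tangentL tangent0 addr0. Qed.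

Lemma tangentN v f : v (- f) = - v f.
Proof. by rewrite -scaleN1r tangentZ mulN1r. Qed.

Lemma tangent_sum v (I : Type) (r : seq I) (F : I -> cinf M) :
  v (\sum_(i <- r) F i) = \sum_(i <- r) v (F i).
Proof.
by elim: r => [|i r IHr]; rewrite ?big_nil ?tangent0// !big_cons tangentD IHr.
Qed.

Lemma tangent_cst v (a : R) : v (a *: (1 : cinf M)) = 0.
Proof.
rewrite tangentZ; suff -> : v 1 = 0 by rewrite mulr0.
by apply: (addrI (v 1)); rewrite addr0 -{3}[1](mul1r 1) tangentM cinfE mulr1 mul1r.
Qed.

Lemma tangentP v w : (forall f, v f = w f) -> v = w.
Proof. by move=> vw; apply: val_inj; apply/funext. Qed.

Lemma tan_sumE (I : Type) (r : seq I) (F : I -> tangent p) f :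
  (\sum_(i <- r) F i : tangent p) f = \sum_(i <- r) F i f.
Proof. by elim/big_rec2 : _ => // i y1 y2 _ <-. Qed.

Lemma tan_lincombE (I : Type) (r : seq I) (a : I -> R) (F : I -> tangent p) f :
  (\sum_(i <- r) a i *: F i : tangent p) f = \sum_(i <- r) a i * F i f.
Proof. exact: tan_sumE. Qed.

(** A bump function [chi] kills [f - g] identically. The Leibniz rule for this zero product, at [p]
    where [chi] is 1 and [f - g] is 0, leaves only [v (f - g)]. *)
Lemma tangent_local v f g : (\forall q \near p, f q = g q) -> v f = v g.
Proof.
rewrite -nbhs_nearE nbhsE => -[W [oW Wp] fg].
have [chi [Z [chi1 oZ ZW chi0]]] := bump_exists oW Wp.
have chip : chi p = 1 by exact: nbhs_singleton chi1.
apply/eqP; rewrite -subr_eq0 -tangentN -tangentD; apply/eqP.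
have E : chi * (f - g) = 0 :> cinf M.
  apply: cinfP => q; rewrite !cinfE; have [/chi0 ->|/fg ->] := ZW q.
    by rewrite mul0r.
  by rewrite subrr mulr0.
have := tangentM v chi (f - g); rewrite E tangent0 chip mul1r.
have -> : (f - g : cinf M) p = 0 by rewrite !cinfE fg// subrr.
by rewrite mulr0 add0r => <-.
Qed.

Lemma coord_vecE (c : chart R n M) i f : atlas c -> cdom c p ->
  coord_vec p c i f = partial i (f \o cinv c) (cmap c p).
Proof.
move=> Ac cp; rewrite /coord_vec; set D := fun f : cinf M => _.
suff Dd : D \in derivation_pred p by rewrite insubdK.
have dv (h : cinf M) : derivable (h \o cinv c) (cmap c p) (delta_mx 0 i : 'rV[R]_n).
  have [_ /(_ i)[d _]] := @cinf_smooth _ _ _ h (cdom c) c Ac 1.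
  by apply: d; exists p.
apply/asboolP; split=> [a g h|g h]; rewrite /D /partial.
  have -> : (a *: g + h : cinf M) \o cinv c = a *: (g \o cinv c : _ -> R^o) + (h \o cinv c) by [].
  by rewrite deriveD ?deriveZ//; exact: derivableZ.
have -> : (g * h : cinf M) \o cinv c = (g \o cinv c : _ -> R^o) * (h \o cinv c) by [].
by rewrite deriveM//= cmapK// addrC mulrC.
Qed.

Section Coordinates.
Variable c : chart R n M.
Hypotheses (Ac : atlas c) (cp : cdom c p).

(** Tangent vectors act on global functions, so a chart coordinate is replaced by a global function
    with the same germ at [p]. *)
Definition coord_ext (i : 'I_n) : cinf M := germ_ext p (fun q => cmap c q 0 i).

Lemma coord_extE i : \forall q \near p, coord_ext i q = cmap c q 0 i.
Proof. exact: germ_extE (open_cdom c) cp (smooth_fun_coord i Ac). Qed.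

Lemma coord_vec_near (V : set 'rV[R]_n) (g : 'rV[R]_n -> R^o) f i :
  nbhs (cmap c p) V -> (forall x, V x -> f (cinv c x) = g x) ->
  coord_vec p c i f = partial i g (cmap c p).
Proof.
move=> nV fg; rewrite coord_vecE// /partial; apply: near_eq_derive.
by apply: filterS nV => x /fg.
Qed.

Lemma near_chart f (g : M -> R^o) : (\forall q \near p, f q = g q) ->
  \forall x \near cmap c p, f (cinv c x) = g (cinv c x).
Proof.
move=> fg; have cimg : (cmap c @` cdom c) (cmap c p) by exists p.
have cc : cinv c @ cmap c p --> p.
  by rewrite -[X in _ --> X](cmapK cp); exact: cinv_continuous.
exact: (cc _ fg).
Qed.

Lemma coord_vec_coord i j : coord_vec p c i (coord_ext j) = (i == j)%:R.
Proof.
have n1 : nbhs (cmap c p) (cmap c @` cdom c).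
  by apply: open_nbhs_nbhs; split; [exact: open_cimg|exists p].
have n2 := near_chart (coord_extE j).
rewrite (coord_vec_near (g := fun x => x 0 j) i (filterI n1 n2)); last first.
  by move=> _ [[q cq <-] /= ->]; rewrite cmapK.
rewrite /partial; apply/cvg_lim => //; apply: cvg_near_cst.
near=> h; rewrite /= !mxE addrK scalerA mulVf; last by near: h; exact: nbhs_dnbhs_neq.
by rewrite scale1r eqxx /= eq_sym.
Unshelve. all: by end_near. Qed.

(* By Hadamard's lemma, [f] agrees near [p] with the sum of a constant and of
   products whose first factor vanishes at [p]. *)
Lemma tangent_coord v : v = \sum_i v (coord_ext i) *: coord_vec p c i.
Proof.
apply: tangentP => f; rewrite tan_lincombE; set a := cmap c p.
pose U := cmap c @` cdom c; have oU : open U by exact: open_cimg.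
have Ua : U a by exists p.
(* The chart image need not be star-shaped about [a], as [hadamard] requires; a ball inside it
   is. *)
have /nbhs_ballP[r /= r0 rU] : nbhs a U by apply: open_nbhs_nbhs.
have oB : open (ball a r) by exact: ball_open.
have Ba : ball a r a by exact: ballxx.
have star x (s : R) : ball a r x -> `[0, 1]%classic s -> ball a r (s *: (x - a) + a).
  rewrite -!ball_normE /= in_itv /= => xr /andP[s0 s1].
  rewrite distrC addrK normrZ; apply: le_lt_trans xr.
  by rewrite distrC ler_piMl// ger0_norm.
pose h := f \o cinv c.
have hs : smooth_on (ball a r) h.
  move=> k; apply: CkS (@cinf_smooth _ _ _ f (cdom c) c Ac k).
  by rewrite setIid.
have had x Bx := @hadamard R n (ball a r) a oB star h x hs Bx.
pose g i := radial a 0 (partial i h).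
have gs i : smooth_on (ball a r) (g i).
  by apply: radial_smooth => //; exact: smooth_partial.
pose W := cdom c `&` cmap c @^-1` (ball a r).
have oW : open W by exact: open_chart_preimage.
have Wp : W p by [].
have Gs i : smooth_fun W (g i \o cmap c) by exact: smooth_fun_chart_on.
pose G i := germ_ext p (g i \o cmap c).
have Gn : \forall q \near p, forall i, G i q = g i (cmap c q).
  apply: (@filter_forall _ _ (fun (i : 'I_n) q => G i q = g i (cmap c q)) (nbhs p) _) => i.
  exact: germ_extE oW Wp (Gs i).
have Xn : \forall q \near p, forall i, coord_ext i q = cmap c q 0 i.
  apply: (@filter_forall _ _ (fun (i : 'I_n) q => coord_ext i q = cmap c q 0 i) (nbhs p) _).
  exact: coord_extE.
have nW : nbhs p W by apply: open_nbhs_nbhs.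
pose ff : cinf M := f p *: (1 : cinf M)
  + \sum_i (coord_ext i - a 0 i *: (1 : cinf M)) * G i.
have fE : \forall q \near p, f q = ff q.
  apply: filterS (filterI nW (filterI Gn Xn)) => q [[cq Bq] [Gq Xq]].
  have -> : ff q = f p + \sum_i (cmap c q 0 i - a 0 i) * g i (cmap c q).
    rewrite /ff cinfD cinfZ cinf1 mulr1 cinf_sum; congr (_ + _); apply: eq_bigr => i _.
    by rewrite cinfM cinfD cinfN cinfZ cinf1 mulr1 Gq Xq.
  have := had _ Bq; rewrite /h /= !cmapK// => <-.
  by rewrite addrC subrK.
rewrite (tangent_local v fE) /ff tangentD tangent_cst add0r tangent_sum.
apply: eq_bigr => i _; rewrite tangentM tangentD tangentN tangent_cst subr0.
have [Gp Xp] : G i p = g i a /\ coord_ext i p = a 0 i.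
  by split; [exact: (nbhs_singleton Gn)|exact: (nbhs_singleton Xn)].
rewrite !cinfE Xp mulr1 subrr mul0r addr0 Gp /g radial0_center.
by rewrite coord_vecE.
Qed.

Lemma tangent_coord_uniq v (a : 'I_n -> R) : v = \sum_i a i *: coord_vec p c i ->
  forall i, a i = v (coord_ext i).
Proof.
move=> vE i; have vi : v (coord_ext i) = \sum_j a j * (j == i)%:R :> R.
  rewrite vE tan_lincombE; apply: eq_bigr => j _; congr (_ * _).
  exact: coord_vec_coord.
rewrite vi (bigD1 i isT) /= eqxx mulr1 big1 ?addr0// => j ji.
by rewrite (negPf ji) mulr0.
Qed.

End Coordinates.
End TangentTheory.

(** * Sections of the pullback tangent bundle and of its dual *)

Section EvaluationForms.
Context {R : realType} {n : nat} {M : manifold R n} (p : M).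

Lemma dualL (V : lmodType R) (xi : dual V) (a : R) u v : xi (a *: u + v) = a * xi u + xi v.
Proof. by have /asboolP := valP xi; exact. Qed.

Lemma dual0 (V : lmodType R) (xi : dual V) : xi 0 = 0.
Proof.
have := dualL xi 1 0 0; rewrite scale1r mul1r addr0 => /eqP.
by rewrite -subr_eq subrr => /eqP.
Qed.

Lemma dualD (V : lmodType R) (xi : dual V) u v : xi (u + v) = xi u + xi v.
Proof. by rewrite -[u]scale1r dualL mul1r scale1r. Qed.

Lemma dualZ (V : lmodType R) (xi : dual V) (a : R) v : xi (a *: v) = a * xi v.
Proof. by rewrite -[a *: v]addr0 dualL dual0 addr0. Qed.

Lemma dual_lincomb (V : lmodType R) (xi : dual V) (I : Type) (r : seq I) (a : I -> R) (F : I -> V) :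
  xi (\sum_(i <- r) a i *: F i) = \sum_(i <- r) a i * xi (F i).
Proof.
elim: r => [|i r IHr]; first by rewrite !big_nil dual0.
by rewrite !big_cons dualL IHr.
Qed.

Lemma dualP (V : lmodType R) (xi eta : dual V) : (forall v, xi v = eta v) -> xi = eta.
Proof. by move=> E; apply: val_inj; apply/funext. Qed.

Lemma dual_lincombE (V : lmodType R) (I : Type) (r : seq I) (a : I -> R) (F : I -> dual V) v :
  (\sum_(i <- r) a i *: F i : dual V) v = \sum_(i <- r) a i * F i v.
Proof. by elim/big_rec2 : _ => // i y1 y2 _ <-. Qed.

Lemma eval_form_subproof (f : cinf M) :
  (fun v : tangent p => v f) \in @linform_pred R (tangent p).
Proof. by apply/asboolP. Qed.

Definition eval_form f : dual (tangent p) := Dual (eval_form_subproof f).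

Lemma eval_formE f (v : tangent p) : eval_form f v = v f. Proof. by []. Qed.

Lemma dual_coord (c : chart R n M) (Ac : atlas c) (cp : cdom c p) (xi : dual (tangent p)) v :
  xi v = \sum_i v (coord_ext p c i) * xi (coord_vec p c i).
Proof. by rewrite {1}(tangent_coord Ac cp v) dual_lincomb. Qed.

(** The dual frame is a choice characterized by its values. Differentials of the extended
    coordinates have these values, and [dual_coord] shows that the values determine the form. *)
Lemma dual_frameE (c : chart R n M) (Ac : atlas c) (cp : cdom c p) i :
  xget 0 [set xi : dual (tangent p) | forall j, xi (coord_vec p c j) = (j == i)%:R]
  = eval_form (coord_ext p c i).
Proof.
case: xgetP => [xi _ xiP|/(_ (eval_form (coord_ext p c i)))[]]; last first.
  by move=> j; rewrite eval_formE coord_vec_coord.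
apply: dualP => v; rewrite (dual_coord Ac cp) eval_formE (bigD1 i isT) big1 => [|j ji].
  by rewrite xiP eqxx mulr1; exact: addr0.
by rewrite xiP (negPf ji) mulr0.
Qed.

Lemma dual_frame_decomp (c : chart R n M) (Ac : atlas c) (cp : cdom c p) (xi : dual (tangent p)) :
  xi = \sum_i xi (coord_vec p c i) *: eval_form (coord_ext p c i).
Proof.
apply: dualP => v; rewrite (dual_coord Ac cp) dual_lincombE; apply: eq_bigr => i _.
by rewrite mulrC.
Qed.

End EvaluationForms.

Section PullbackTangent.
Context {R : realType} {n : nat} {M : manifold R n} (phi : smooth_map M M).
Local Notation T := (pull_tangent phi).
Local Notation T' := (dual_bundle T).
Implicit Types (W : set M) (c : chart R n M) (f : cinf M).

Lemma open_pull_cdom c : open (phi @^-1` cdom c).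
Proof. exact: open_preimage_smap (open_cdom c). Qed.

Lemma smooth_coord_vec c i f : atlas c ->
  smooth_fun (phi @^-1` cdom c) (fun p => coord_vec (phi p) c i f).
Proof.
move=> Ac; pose g := partial i (f \o cinv c).
have gs : smooth_fun (M := M) (cdom c) (g \o cmap c).
  apply: smooth_fun_chart => //; apply: smooth_partial => k.
  by have := @cinf_smooth _ _ _ f (cdom c) c Ac k; rewrite setIid.
have := @smooth_fun_comp _ _ _ phi _ _ (open_cdom c) gs.
apply: smooth_fun_eq; first exact: open_pull_cdom.
by move=> p cp /=; rewrite coord_vecE.
Qed.

Lemma frames_T (F : frame (bidx T) (fib T)) : @frames _ _ _ T F -> exists2 c, atlas c &
  F = Frame (open_preimage_smap phi (open_cdom c)) (fun i p => coord_vec (phi p) c i).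
Proof. by case=> G [c Ac ->] ->; exists c. Qed.

Lemma chart_frame_T c : atlas c ->
  @frames _ _ _ T (Frame (open_preimage_smap phi (open_cdom c)) (fun i p => coord_vec (phi p) c i)).
Proof. by move=> Ac; exists (Frame (open_cdom c) (fun i p => coord_vec p c i)) => //; exists c. Qed.

Lemma smooth_section_act W (s : rawsec T) f : open W -> smooth_section W s ->
  smooth_fun W (fun p => (s p : tangent (phi p)) f).
Proof.
move=> oW ss; apply: smooth_fun_cover => p Wp; have [c Ac cp] := atlas_cover (phi p).
have [a [as_ sE]] := ss _ (chart_frame_T Ac).
have oV : open (W `&` phi @^-1` cdom c) by apply: openI => //; exact: open_pull_cdom.
exists (W `&` phi @^-1` cdom c); split=> //.
apply: (@smooth_fun_eq _ _ _ _ (fun q => \sum_i a i q * coord_vec (phi q) c i f)) => //.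
  by move=> q [Wq cq]; rewrite [s q]sE//= tan_lincombE.
apply: smooth_fun_sum => // i.
apply: (@smooth_funM _ _ _ _ (a i) (fun q => coord_vec (phi q) c i f)) => //.
by apply: smooth_funS (smooth_coord_vec i f Ac) => q [].
Qed.

(** The components of [s] in a chart are its actions on [coord_ext (phi q) c i], a function that
    varies with [q]. Near a fixed [p] they equal the actions on the single function
    [coord_ext (phi p) c i], because tangent vectors are local. *)
Lemma act_smooth_section W (s : rawsec T) : open W ->
  (forall f, smooth_fun W (fun p => (s p : tangent (phi p)) f)) -> smooth_section W s.
Proof.
move=> oW ss F /frames_T[c Ac ->] /=.
exists (fun i p => (s p : tangent (phi p)) (coord_ext (phi p) c i)).
split=> [i|p Wp cp]; last first.
  exact: (tangent_coord Ac cp).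
apply: smooth_fun_cover => p [Wp cp].
have := @coord_extE _ _ _ (phi p) c Ac cp i; rewrite -nbhs_nearE nbhsE => -[V [oV Vp] VE].
have oN : open (W `&` phi @^-1` V) by apply: openI => //; exact: open_preimage_smap.
have oD : open (phi @^-1` cdom c) by exact: open_pull_cdom.
exists (W `&` phi @^-1` V `&` phi @^-1` cdom c); split=> //; first exact: openI.
apply: (@smooth_fun_eq _ _ _ _ (fun q => (s q : tangent (phi q)) (coord_ext (phi p) c i))) => //.
- exact: openI.
- move=> q [[Wq Vq] cq]; apply: tangent_local.
  have nV : nbhs (phi q) V by apply: open_nbhs_nbhs.
  by apply: filterS (filterI nV (coord_extE Ac cq i)) => z [/VE -> ->].
- by apply: smooth_funS (ss _) => q [[]].
Qed.

Lemma smooth_section_pairing W (xi : rawsec T') (x : rawsec T) : open W ->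
  smooth_section W xi -> smooth_section W x ->
  smooth_fun W (fun p => (xi p : dual (fib T p)) (x p)).
Proof.
move=> oW xis xs; apply: smooth_fun_cover => p Wp; have [c Ac cp] := atlas_cover (phi p).
have [a [as_ aE]] := xis _ (ex_intro2 _ _ _ (chart_frame_T Ac) erefl).
have [b [bs bE]] := xs _ (chart_frame_T Ac).
have oV : open (W `&` phi @^-1` cdom c) by apply: openI => //; exact: open_pull_cdom.
exists (W `&` phi @^-1` cdom c); split=> //.
apply: (@smooth_fun_eq _ _ _ _ (fun q => \sum_i a i q * b i q)) => //; last first.
  by apply: smooth_fun_sum => // i; apply: (@smooth_funM _ _ _ _ (a i) (b i)).
move=> q [Wq cq]; have {}aE := aE q Wq cq; have {}bE := bE q Wq cq.
rewrite /= in aE bE.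
rewrite [xi q]aE dual_lincombE; apply: eq_bigr => i _; congr (_ * _).
rewrite (dual_frameE Ac cq) eval_formE.
exact: (tangent_coord_uniq Ac cq bE).
Qed.

End PullbackTangent.

Section LocalFrames.
Context {R : realType} {n : nat} {M : manifold R n} (phi : smooth_map M M).
Local Notation T := (pull_tangent phi).
Local Notation T' := (dual_bundle T).
Implicit Types (W : set M) (c : chart R n M) (f : cinf M).

Lemma sec_smooth (E : prebundle M) (x : sec E) : smooth_section setT (sec_val x).
Proof. by have /asboolP := valP x; exact. Qed.

Lemma secP (E : prebundle M) (x y : sec E) : (forall m, x m = y m) -> x = y.
Proof. by move=> xy; apply: val_inj; apply: functional_extensionality_dep. Qed.

Lemma coord_section c p i : atlas c -> cdom c (phi p) ->
  exists e : sec T, \forall q \near p, e q = coord_vec (phi q) c i.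
Proof.
move=> Ac cp; have oW : open (phi @^-1` cdom c) := @open_pull_cdom _ _ _ phi c.
have [chi [Z [chi1 oZ ZW chi0]]] := bump_exists oW cp.
pose s : rawsec T := fun q => chi q *: (coord_vec (phi q) c i : fib T q).
have ss : smooth_section setT s.
  apply: act_smooth_section; first exact: openT.
  move=> f; apply: smooth_fun_cover => q _; have [Zq|Wq] := ZW q.
    exists Z; split=> //; apply: smooth_fun_eq (smooth_fun_cst _ 0) => // q' /chi0 E.
    by rewrite /s E scale0r.
  exists (phi @^-1` cdom c); split=> //.
  apply: (@smooth_funM _ _ _ _ chi (fun q => coord_vec (phi q) c i f)) => //.
    exact: cinf_smooth.
  exact: smooth_coord_vec.
have sP : s \in @smooth_sec_pred _ _ _ T by apply/asboolP.
exists (Sec sP); apply: filterS chi1 => q E.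
by rewrite /sec_at /= /s E scale1r.
Qed.

Lemma coord_sections c p : atlas c -> cdom c (phi p) ->
  exists e : 'I_n -> sec T, \forall q \near p, forall i, e i q = coord_vec (phi q) c i.
Proof.
move=> Ac cp; have [e eE] := choice (fun i => coord_section i Ac cp).
exists e; exact: (@filter_forall _ _ (fun i q => e i q = coord_vec (phi q) c i) (nbhs p) _).
Qed.

(** The factor [chi] turns the local expansion in a frame into an identity on all of [M] between
    global objects, to which operators on global sections can be applied. *)
Lemma local_frame p : exists (chi : cinf M) (X : 'I_n -> cinf M) (e : 'I_n -> sec T),
  [/\ chi p = 1,
      forall v : tangent (phi p), v = \sum_i v (X i) *: (e i p : tangent (phi p))
    & forall (x : rawsec T) q, chi q *: (x q : tangent (phi q))
        = \sum_i (chi q * (x q : tangent (phi q)) (X i)) *: (e i q : tangent (phi q))].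
Proof.
have [c Ac cp] := atlas_cover (phi p); have [e eE] := coord_sections Ac cp.
pose X i := coord_ext (phi p) c i.
have XE : \forall z \near phi p, forall i, X i z = cmap c z 0 i.
  apply: (@filter_forall _ _ (fun i z => X i z = cmap c z 0 i) (nbhs (phi p)) _) => i.
  exact: coord_extE.
move: eE XE; rewrite -!nbhs_nearE !nbhsE => -[V1 [oV1 V1p] V1E] [V2 [oV2 V2p] V2E].
pose W := V1 `&` (phi @^-1` V2 `&` phi @^-1` cdom c).
have oW : open W.
  by apply: openI => //; apply: openI; [exact: open_preimage_smap|exact: open_pull_cdom].
have frameW q : W q -> forall v : tangent (phi q), v = \sum_i v (X i) *: (e i q : tangent (phi q)).
  move=> [V1q [V2q cq]] v; rewrite {1}(tangent_coord Ac cq v); apply: eq_bigr => i _.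
  rewrite -(V1E _ V1q) (_ : v (coord_ext _ _ _) = v (X i))//; apply: tangent_local.
  have nV : nbhs (phi q) V2 by apply: open_nbhs_nbhs.
  by apply: filterS (filterI nV (coord_extE Ac cq i)) => z [/V2E -> ->].
have Wp : W p by [].
have [chi [Z [chi1 oZ ZW chi0]]] := bump_exists oW Wp.
exists chi, X, e; split; [exact: nbhs_singleton chi1|exact: frameW|].
move=> x q; have [/chi0 ->|/frameW E] := ZW q.
  by rewrite scale0r big1// => i _; rewrite mul0r scale0r.
by rewrite {1}(E (x q)) scaler_sumr; apply: eq_bigr => i _; rewrite scalerA.
Qed.

Lemma section_through p (v : tangent (phi p)) : exists x : sec T, x p = v.
Proof.
have [chi [X [e [_ vE _]]]] := local_frame p.
exists (\sum_i v (X i) *: e i); rewrite {2}(vE v).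
elim/big_rec2 : _ => // i y1 y2 _ <-.
by [].
Qed.

(** The components of [xi] are its pairings with coordinate fields, and near each point these fields
    extend to global sections. *)
Lemma smooth_section_of_pairing W (xi : rawsec T') : open W ->
  (forall x : sec T, smooth_fun W (fun p => (xi p : dual (fib T p)) (x p))) ->
  smooth_section W xi.
Proof.
move=> oW xis F [G /frames_T[c Ac ->] ->] /=.
exists (fun i p => (xi p : dual (tangent (phi p))) (coord_vec (phi p) c i)).
split=> [i|p Wp cp]; last first.
  rewrite {1}(dual_frame_decomp Ac cp (xi p)); apply: eq_bigr => i _.
  by rewrite (dual_frameE Ac cp).
apply: smooth_fun_cover => p [Wp cp]; have [e eE] := coord_section i Ac cp.
move: eE; rewrite -!nbhs_nearE !nbhsE => -[V [oV Vp] VE].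
exists (W `&` V); split=> //; first exact: openI.
apply: (@smooth_fun_eq _ _ _ _ (fun q => (xi q : dual (fib T q)) (e q))).
- exact: openI.
- by move=> q [Wq Vq]; rewrite VE.
- by apply: smooth_funS (xis e) => q [].
Qed.

Lemma dual_vector_bundle : is_vector_bundle T'.
Proof.
split=> [p|F|F].
- have [c Ac cp] := atlas_cover (phi p).
  by eexists; [exists (Frame (open_preimage_smap phi (open_cdom c))
    (fun i p => coord_vec (phi p) c i)); [exact: chart_frame_T|reflexivity]|].
- move=> [G /frames_T[c Ac ->] ->] p /= cp xi.
  exists [ffun i => (xi : dual (tangent (phi p))) (coord_vec (phi p) c i)].
  split=> [|w xiE].
    rewrite {1}(dual_frame_decomp Ac cp xi); apply: eq_bigr => i _.
    by rewrite (dual_frameE Ac cp) ffunE.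
  apply/ffunP => i; rewrite ffunE xiE dual_lincombE (bigD1 i isT) big1 => [|j ji].
    by rewrite (dual_frameE Ac cp) eval_formE coord_vec_coord// eqxx mulr1; exact: addr0.
  by rewrite (dual_frameE Ac cp) eval_formE coord_vec_coord// eq_sym (negPf ji) mulr0.
- move=> [G /frames_T[c Ac ->] ->] i /=.
  have oW : open (phi @^-1` cdom c) := @open_pull_cdom _ _ _ phi c.
  apply: smooth_section_of_pairing => // x; apply: smooth_fun_cover => p cp.
  have := @coord_extE _ _ _ (phi p) c Ac cp i; rewrite -nbhs_nearE nbhsE => -[V [oV Vp] VE].
  have oN : open (phi @^-1` V `&` phi @^-1` cdom c).
    by apply: openI => //; exact: open_preimage_smap.
  exists (phi @^-1` V `&` phi @^-1` cdom c); split=> //.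
  apply: (@smooth_fun_eq _ _ _ _ (fun q => (x q : tangent (phi q)) (coord_ext (phi p) c i))) => //.
    move=> q [Vq cq]; rewrite (dual_frameE Ac cq) eval_formE; apply: tangent_local.
    have nV : nbhs (phi q) V by apply: open_nbhs_nbhs.
    by apply: filterS (filterI nV (coord_extE Ac cq i)) => z [/VE -> ->].
  exact: smooth_funS (smooth_section_act (coord_ext (phi p) c i) openT (sec_smooth x)).
Qed.

End LocalFrames.

(** * Sections defined by twisted derivations and by tensorial forms *)

Section SectionCalculus.
Context {R : realType} {n : nat} {M : manifold R n} (phi : diffeo M).
Local Notation T := (pull_tangent phi).
Local Notation T' := (dual_bundle T).
Local Notation phis := (pull_fun phi).
Local Notation phisV := (pull_fun (dbwd phi)).
Implicit Types (f g : cinf M) (x y z : sec T) (xi eta : sec T') (m : M).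

Lemma actE x f m : act x f m = (x m : tangent (phi m)) f.
Proof. by rewrite /act to_cinfE//; exact: smooth_section_act openT (sec_smooth x). Qed.

Lemma pairingE xi x m : pairing xi x m = (xi m : dual (fib T m)) (x m).
Proof.
by rewrite /pairing to_cinfE//; exact: smooth_section_pairing openT (sec_smooth xi) (sec_smooth x).
Qed.

Lemma pull_funE (psi : smooth_map M M) f m : pull_fun psi f m = f (psi m).
Proof.
rewrite /pull_fun to_cinfE//.
have := @smooth_fun_comp _ _ _ psi _ _ openT (cinf_smooth f setT).
by rewrite preimage_setT.
Qed.

Lemma phisK : cancel phis phisV.
Proof. by move=> f; apply: cinfP => m; rewrite !pull_funE dbwdK. Qed.

Lemma phisVK : cancel phisV phis.
Proof. by move=> f; apply: cinfP => m; rewrite !pull_funE dfwdK. Qed.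

Lemma pull_funL (psi : smooth_map M M) (a : R) f g :
  pull_fun psi (a *: f + g) = a *: pull_fun psi f + pull_fun psi g.
Proof. by apply: cinfP => m; rewrite cinfD cinfZ !pull_funE cinfD cinfZ. Qed.

Lemma pull_funM (psi : smooth_map M M) f g :
  pull_fun psi (f * g) = pull_fun psi f * pull_fun psi g.
Proof. by apply: cinfP => m; rewrite cinfM !pull_funE cinfM. Qed.

Lemma pull_funD (psi : smooth_map M M) f g :
  pull_fun psi (f + g) = pull_fun psi f + pull_fun psi g.
Proof. by rewrite -[f]scale1r pull_funL !scale1r. Qed.

Lemma pull_fun0 (psi : smooth_map M M) : pull_fun psi 0 = 0.
Proof. by apply: cinfP => m; rewrite pull_funE. Qed.

Lemma pull_funZ (psi : smooth_map M M) (a : R) f : pull_fun psi (a *: f) = a *: pull_fun psi f.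
Proof. by rewrite -[a *: f]addr0 pull_funL pull_fun0 addr0. Qed.

Lemma pull_funN (psi : smooth_map M M) f : pull_fun psi (- f) = - pull_fun psi f.
Proof. by rewrite -scaleN1r pull_funZ scaleN1r. Qed.

Lemma pull_fun_sum (psi : smooth_map M M) (I : Type) (r : seq I) (F : I -> cinf M) :
  pull_fun psi (\sum_(i <- r) F i) = \sum_(i <- r) pull_fun psi (F i).
Proof. by elim: r => [|i r IHr]; rewrite ?big_nil ?pull_fun0// !big_cons pull_funD IHr. Qed.

Lemma actL x (a : R) f g : act x (a *: f + g) = a *: act x f + act x g.
Proof. by apply: cinfP => m; rewrite cinfD cinfZ !actE tangentL. Qed.

Lemma actM x f g : act x (f * g) = act x f * phis g + phis f * act x g.
Proof. by apply: cinfP => m; rewrite cinfD !cinfM !actE !pull_funE tangentM. Qed.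

Lemma actD x f g : act x (f + g) = act x f + act x g.
Proof. by rewrite -[f]scale1r actL !scale1r. Qed.

Lemma act0 x : act x 0 = 0.
Proof. by apply: cinfP => m; rewrite actE tangent0. Qed.

Lemma actZ x (a : R) f : act x (a *: f) = a *: act x f.
Proof. by rewrite -[a *: f]addr0 actL act0 addr0. Qed.

Lemma actN x f : act x (- f) = - act x f.
Proof. by rewrite -scaleN1r actZ scaleN1r. Qed.

Lemma act_sum x (I : Type) (r : seq I) (F : I -> cinf M) :
  act x (\sum_(i <- r) F i) = \sum_(i <- r) act x (F i).
Proof. by elim: r => [|i r IHr]; rewrite ?big_nil ?act0// !big_cons actD IHr. Qed.

Lemma smulE (E : prebundle M) f (s : sec E) m : smul f s m = f m *: s m.
Proof. by []. Qed.

Lemma sec_sumE (E : prebundle M) (I : Type) (r : seq I) (s : I -> sec E) m :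
  (\sum_(i <- r) s i : sec E) m = \sum_(i <- r) s i m.
Proof. by elim/big_rec2 : _ => // i y1 y2 _ <-. Qed.

Lemma act_addl x y f : act (x + y) f = act x f + act y f.
Proof. by apply: cinfP => m; rewrite cinfD !actE. Qed.

Lemma act_scalel (a : R) x f : act (a *: x) f = a *: act x f.
Proof. by apply: cinfP => m; rewrite cinfZ !actE. Qed.

Lemma act_oppl x f : act (- x) f = - act x f.
Proof. by rewrite -scaleN1r act_scalel scaleN1r. Qed.

Lemma act_smul g x f : act (smul g x) f = g * act x f.
Proof. by apply: cinfP => m; rewrite cinfM !actE. Qed.

Lemma act_inj x y : (forall f, act x f = act y f) -> x = y.
Proof.
move=> xy; apply: secP => m; apply: tangentP => f.
by have := congr1 (fun h : cinf M => h m) (xy f); rewrite !actE.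
Qed.

(** The twisted Leibniz rule evaluated at [m] is the Leibniz rule at [phi m]. So [D] gives a tangent
    vector at [phi m] for every [m], and these form a smooth section by [act_smooth_section]. *)
Lemma sec_of_derivationE (D : cinf M -> cinf M) f :
  (forall (a : R) f g, D (a *: f + g) = a *: D f + D g) ->
  (forall f g, D (f * g) = D f * phis g + phis f * D g) ->
  act (sec_of_derivation phi D) f = D f.
Proof.
move=> DL DM.
have Dm m : (fun f => D f m) \in derivation_pred (phi m).
  apply/asboolP; split=> [a g h|g h]; first by rewrite DL cinfD cinfZ.
  by rewrite DM cinfD !cinfM !pull_funE.
pose s : rawsec T := fun m => Tangent (Dm m).
have ss : s \in @smooth_sec_pred _ _ _ T.
  apply/asboolP; apply: act_smooth_section; first exact: openT.
  by move=> g; exact: cinf_smooth.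
rewrite /sec_of_derivation; case: xgetP => [x _ //|/(_ (Sec ss))[]] g.
by apply: cinfP => m; rewrite actE.
Qed.

Lemma pairing_addr xi x y : pairing xi (x + y) = pairing xi x + pairing xi y.
Proof. by apply: cinfP => m; rewrite cinfD !pairingE dualD. Qed.

Lemma pairing_smulr xi g x : pairing xi (smul g x) = g * pairing xi x.
Proof. by apply: cinfP => m; rewrite cinfM !pairingE dualZ. Qed.

Lemma pairing_scaler xi (a : R) x : pairing xi (a *: x) = a *: pairing xi x.
Proof. by apply: cinfP => m; rewrite cinfZ !pairingE dualZ. Qed.

Lemma pairing_oppr xi x : pairing xi (- x) = - pairing xi x.
Proof. by rewrite -scaleN1r pairing_scaler scaleN1r. Qed.

Lemma pairing_addl xi eta x : pairing (xi + eta) x = pairing xi x + pairing eta x.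
Proof. by apply: cinfP => m; rewrite cinfD !pairingE. Qed.

Lemma pairing_scalel (a : R) xi x : pairing (a *: xi) x = a *: pairing xi x.
Proof. by apply: cinfP => m; rewrite cinfZ !pairingE. Qed.

Lemma pairing_smull g xi x : pairing (smul g xi) x = g * pairing xi x.
Proof. by apply: cinfP => m; rewrite cinfM !pairingE. Qed.

(** By [section_through] each vector of a fibre is the value of a global section. *)
Lemma pairing_inj xi eta : (forall x, pairing xi x = pairing eta x) -> xi = eta.
Proof.
move=> E; apply: secP => m; apply: dualP => v; have [x <-] := section_through v.
by have := congr1 (fun h : cinf M => h m) (E x); rewrite !pairingE.
Qed.

Section Tensorial.
Variable F : sec T -> cinf M.
Hypotheses (FD : forall x y, F (x + y) = F x + F y)
  (FM : forall f x, F (smul f x) = f * F x).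

Let FZ (a : R) x : F (a *: x) = a *: F x.
Proof.
rewrite cinf_scaleE -FM; congr F; apply: act_inj => f.
by rewrite act_smul act_scalel -cinf_scaleE.
Qed.

Let FN x : F (- x) = - F x.
Proof. by rewrite -scaleN1r FZ scaleN1r. Qed.

Let F_sum (I : Type) (r : seq I) (X : I -> sec T) :
  F (\sum_(i <- r) X i) = \sum_(i <- r) F (X i).
Proof.
elim: r => [|i r IHr]; last by rewrite !big_cons FD IHr.
by rewrite !big_nil -(scale0r 0) FZ scale0r.
Qed.

(* Up to a bump function, [x] is a combination of a local frame whose
   coefficients vanish at [m]. *)
Let F_pointwise m x : (x m : tangent (phi m)) = 0 -> F x m = 0.
Proof.
move=> x0; have [chi [X [e [chim _ xE]]]] := local_frame phi m.
have E : smul chi x = \sum_i smul (chi * act x (X i)) (e i).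
  apply: secP => q; rewrite sec_sumE.
  transitivity (\sum_i (chi q * (x q : tangent (phi q)) (X i)) *: (e i q : tangent (phi q))).
    exact: xE.
  by apply: eq_bigr => i _; rewrite smulE cinfM actE.
have := congr1 (fun h : cinf M => h m) (congr1 F E).
rewrite FM F_sum cinfM chim mul1r => ->; rewrite cinf_sum big1// => i _.
by rewrite FM !cinfM actE x0 mulr0 mul0r.
Qed.

(** By [F_pointwise] the value of [F x] at [m] depends only on [x m]. Extending vectors to global
    sections thus defines a linear form on each fibre, whatever extension [lift] picks. *)
Lemma sec_of_formE x : pairing (sec_of_form F) x = F x.
Proof.
pose lift m (v : fib T m) : sec T := xget 0 [set x : sec T | x m = v].
have liftE m (v : fib T m) : lift m v m = v.
  rewrite /lift; case: xgetP => [y _ //|nE].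
  by have [y yv] := @section_through _ _ _ phi m v; case: (nE y).
have F_eq m y z : y m = z m -> F y m = F z m.
  move=> yz; have := @F_pointwise m (y - z).
  rewrite FD FN cinfD cinfN => E; apply/eqP; rewrite -subr_eq0; apply/eqP; apply: E.
  by rewrite [LHS](_ : _ = y m - z m)// yz subrr.
have xim m : (fun v => F (lift m v) m) \in @linform_pred R (fib T m).
  apply/asboolP => a u v.
  rewrite (F_eq m (lift m (a *: u + v)) (a *: lift m u + lift m v)).
    by rewrite FD FZ cinfD cinfZ.
  rewrite liftE; transitivity (a *: lift m u m + lift m v m); last by [].
  by rewrite !liftE.
pose xi : rawsec T' := fun m => Dual (xim m).
have xiE y m : (xi m : dual (fib T m)) (y m) = F y m by apply: F_eq; exact: liftE.
have xis : xi \in @smooth_sec_pred _ _ _ T'.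
  apply/asboolP; apply: smooth_section_of_pairing; first exact: openT.
  move=> y; apply: (@smooth_fun_eq _ _ _ _ (F y)); first exact: openT.
    by move=> m _; rewrite xiE.
  exact: cinf_smooth.
rewrite /sec_of_form; case: xgetP => [eta _ //|/(_ (Sec xis))[]] y.
by apply: cinfP => m; rewrite pairingE.
Qed.

End Tensorial.

End SectionCalculus.

(* [ring] compares atoms up to conversion, which diverges on unfolded smooth
   functions; the atoms are therefore first replaced by variables. *)
Ltac cinf_ring :=
  repeat match goal with
  | |- context [@pull_fun ?R ?n ?M ?p ?f] => generalize (@pull_fun R n M p f); intro
  | |- context [@act ?R ?n ?M ?p ?x ?f] => generalize (@act R n M p x f); intro
  | |- context [@pairing ?R ?n ?M ?p ?x ?f] => generalize (@pairing R n M p x f); intro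
  end; ring.

(** * The bracket, differential and Lie derivative of the pullback tangent bundle *)

Section HomCalculus.
Context {R : realType} {n : nat} {M : manifold R n} (phi : diffeo M).
Local Notation T := (pull_tangent phi).
Local Notation T' := (dual_bundle T).
Local Notation phis := (pull_fun phi).
Local Notation phisV := (pull_fun (dbwd phi)).
Implicit Types (f g : cinf M) (x y z : sec T) (xi eta : sec T').

Lemma act_Ad x f : act (Ad x) f = phis (act x (phisV f)).
Proof.
apply: (sec_of_derivationE (D := fun f => phis (act x (phisV f)))) => [a g h|g h].
  by rewrite !(pull_funL, actL).
by rewrite !(pull_funM, actM, pull_funD) !phisVK.
Qed.

Lemma act_AdV x f : act (AdV x) f = phisV (act x (phis f)).
Proof.
apply: (sec_of_derivationE (D := fun f => phisV (act x (phis f)))) => [a g h|g h].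
  by rewrite !(pull_funL, actL).
by rewrite !(pull_funM, actM, pull_funD) !phisK.
Qed.

(** The commutator is a twisted derivation: the products of a derivative by [x] with a derivative by
    [y] cancel in the difference. *)
Lemma act_bracket x y f : act (bracket x y) f =
  phis (act x (phisV (act y (phisV f)))) - phis (act y (phisV (act x (phisV f)))).
Proof.
apply: (sec_of_derivationE (D := fun f => phis (act x (phisV (act y (phisV f)))) -
  phis (act y (phisV (act x (phisV f)))))) => [a g h|g h].
  by rewrite !(pull_funL, actL) scalerBr opprD addrACA.
by rewrite !(pull_funM, actM, pull_funD, actD, phisVK); cinf_ring.
Qed.

Lemma AdK : cancel (@Ad _ _ _ phi) (@AdV _ _ _ phi).
Proof. by move=> x; apply: act_inj => f; rewrite act_AdV act_Ad !phisK. Qed.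

Lemma AdVK : cancel (@AdV _ _ _ phi) (@Ad _ _ _ phi).
Proof. by move=> x; apply: act_inj => f; rewrite act_Ad act_AdV !phisVK. Qed.

Lemma AdVD x y : AdV (x + y) = AdV x + AdV y.
Proof. by apply: act_inj => f; rewrite act_addl !act_AdV act_addl pull_funD. Qed.

Lemma AdV_smul f x : AdV (smul f x) = smul (phisV f) (AdV x).
Proof. by apply: act_inj => g; rewrite act_smul !act_AdV act_smul pull_funM. Qed.

Lemma pairing_Ad_dag xi x : pairing (Ad_dag xi) x = phis (pairing xi (AdV x)).
Proof.
apply: (sec_of_formE (F := fun x => phis (pairing xi (AdV x)))) => [y z|f y].
  by rewrite AdVD pairing_addr pull_funD.
by rewrite AdV_smul pairing_smulr pull_funM phisVK.
Qed.

Lemma pairing_dif f x : pairing (dif phi f) x = act x f.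
Proof.
apply: (sec_of_formE (F := fun x => act x f)) => [y z|g y]; first exact: act_addl.
exact: act_smul.
Qed.

Lemma bracketDr x y z : bracket x (y + z) = bracket x y + bracket x z.
Proof.
apply: act_inj => f; rewrite act_addl !act_bracket !(act_addl, pull_funD, actD).
by cinf_ring.
Qed.

Lemma bracket_smulr x f y :
  bracket x (smul f y) = smul (phis f) (bracket x y) + smul (act (Ad x) f) (Ad y).
Proof.
apply: act_inj => g; rewrite !(act_addl, act_smul, act_bracket, act_Ad).
by rewrite !(act_smul, pull_funM, actM, phisVK, pull_funD); cinf_ring.
Qed.

(** The right-hand side is tensorial in [y]: the derivative of the coefficient coming from [actM] is
    cancelled by the one coming from [bracket_smulr]. *)
Lemma pairing_lie x eta y : pairing (lie x eta) y =
  act (Ad x) (pairing eta (AdV y)) - pairing (Ad_dag eta) (bracket x (AdV y)).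
Proof.
apply: (sec_of_formE (F := fun y => act (Ad x) (pairing eta (AdV y))
  - pairing (Ad_dag eta) (bracket x (AdV y)))) => [z1 z2|f z].
  by rewrite AdVD pairing_addr bracketDr pairing_addr actD; cinf_ring.
rewrite AdV_smul pairing_smulr bracket_smulr pairing_addr !pairing_smulr actM.
by rewrite AdVK !phisVK (pairing_Ad_dag eta z); cinf_ring.
Qed.

Lemma Ad_dag_linear : linear (@Ad_dag _ _ _ phi).
Proof.
move=> a xi eta; apply: pairing_inj => x.
by rewrite !(pairing_addl, pairing_scalel, pairing_Ad_dag, pull_funL).
Qed.

Lemma Ad_dag_smul f xi : Ad_dag (smul f xi) = smul (phis f) (Ad_dag xi).
Proof.
by apply: pairing_inj => x; rewrite !(pairing_smull, pairing_Ad_dag, pull_funM).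
Qed.

Lemma Ad_dag_dif f : Ad_dag (dif phi f) = dif phi (phis f).
Proof.
by apply: pairing_inj => x; rewrite pairing_Ad_dag !pairing_dif act_AdV phisVK.
Qed.

Lemma pairing_Ad_dag_Ad xi x : pairing (Ad_dag xi) (Ad x) = phis (pairing xi x).
Proof. by rewrite pairing_Ad_dag AdK. Qed.


(** The dual of [local_frame]: the coefficients are the pairings of [xi] with the frame, cut off by
    [chi]. The functions [chi] and [X] serve all forms at once. *)
Lemma form_local_generators m : exists (chi : cinf M) (X : 'I_n -> cinf M),
  chi m = 1 /\ forall xi, exists g : 'I_n -> cinf M,
    smul chi xi = \sum_i smul (g i) (dif phi (X i)).
Proof.
have [chi [X [e [chim _ xE]]]] := local_frame phi m.
exists chi, X; split=> // xi; exists (fun i => chi * pairing xi (e i)).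
apply: pairing_inj => x; apply: cinfP => q; rewrite pairing_smull cinfM !pairingE.
rewrite sec_sumE; transitivity ((xi q : dual (fib T q)) (chi q *: (x q : tangent (phi q)))).
  by rewrite dualZ.
rewrite [X in (xi q : dual _) X](xE (sec_val x) q) dual_lincomb.
transitivity (\sum_i (chi q * pairing xi (e i) q) * (dif phi (X i) q : dual (fib T q)) (x q)).
  by apply: eq_bigr => i _; rewrite -(pairingE (dif _ _)) pairing_dif actE pairingE; ring.
by rewrite -(dual_lincombE (index_enum 'I_n)).
Qed.

End HomCalculus.

(** * The cotangent algebroid of a Hom-Poisson structure *)

Section SmallDeterminants.
Context {A : comPzRingType}.

Lemma det_matrix2 (F : 'I_2 -> 'I_2 -> A) :
  let i1 : 'I_2 := lift ord0 ord0 in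
  \det (\matrix_(a, b) F a b) = F ord0 ord0 * F i1 i1 - F ord0 i1 * F i1 ord0.
Proof.
move=> i1; rewrite (expand_det_row _ ord0) big_ord_recl big_ord1 /cofactor !det_mx11 !mxE /=.
rewrite (_ : lift i1 0 = ord0); last exact: val_inj.
by rewrite expr0 expr1 mul1r mulN1r mulrN.
Qed.

Lemma det_matrix3 (F : 'I_3 -> 'I_3 -> A) :
  let i1 : 'I_3 := lift ord0 ord0 in let i2 : 'I_3 := lift ord0 (lift ord0 ord0) in
  \det (\matrix_(a, b) F a b)
  = F ord0 ord0 * (F i1 i1 * F i2 i2 - F i1 i2 * F i2 i1)
    - F ord0 i1 * (F i1 ord0 * F i2 i2 - F i1 i2 * F i2 ord0)
    + F ord0 i2 * (F i1 ord0 * F i2 i1 - F i1 i1 * F i2 ord0).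
Proof.
move=> i1 i2; rewrite (expand_det_row _ ord0) !big_ord_recl big_ord0 /cofactor.
have minor j : row' ord0 (col' j (\matrix_(a, b) F a b))
    = \matrix_(a, b) F (lift ord0 a) (lift j b).
  by apply/matrixP => a b; rewrite !mxE.
rewrite !minor !det_matrix2 !mxE /=.
have -> : lift (lift ord0 ord0 : 'I_3) ord0 = ord0 by exact: val_inj.
have -> : lift i2 ord0 = ord0 by exact: val_inj.
have -> : lift (lift ord0 ord0 : 'I_3) (lift ord0 ord0) = i2 by exact: val_inj.
have -> : lift i2 (lift ord0 ord0) = i1 by exact: val_inj.
rewrite -/i1 -/i2 /bump /= expr0 expr1 sqrrN expr1n addr0.
by rewrite !mul1r mulN1r mulrN addrA.
Qed.
End SmallDeterminants.

Section BivectorField.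
Context {R : realType} {n : nat} {M : manifold R n} (phi : diffeo M).
Local Notation T := (pull_tangent phi).
Local Notation T' := (dual_bundle T).
Implicit Types (f g : cinf M) (x y z : sec T) (xi eta : sec T') (m : M).

Variables (pi : sec (ext_bundle 2 T)) (xs : seq ('I_2 -> sec T)).
Hypothesis pi_xs : sec_val pi = \sum_(x <- xs) wedge_sec x.

Lemma ext_sumE (I : Type) (r : seq I) (k : nat) (P : I -> rawsec (ext_bundle k T)) m
    (zeta : 'I_k -> dual (fib T m)) :
  ((\sum_(i <- r) P i : rawsec (ext_bundle k T)) m : ext k (fib T m)) zeta
  = \sum_(i <- r) (P i m : ext k (fib T m)) zeta.
Proof. by elim/big_rec2 : _ => // i y1 y2 _ <-. Qed.

Local Notation i0 := (ord0 : 'I_2).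
Local Notation i1 := (lift ord0 ord0 : 'I_2).

Lemma pi_atE m (xi eta : dual (fib T m)) : pi_at pi xi eta
  = \sum_(x <- xs) (xi (x i0 m) * eta (x i1 m) - xi (x i1 m) * eta (x i0 m)).
Proof.
rewrite /pi_at /sec_at pi_xs ext_sumE; apply: eq_bigr => x _.
exact: (@det_matrix2 R (fun a b => (if a == ord0 then xi else eta) (x b m))).
Qed.

(** A decomposition of [pi] exhibits a vector representing the form [pi_at pi xi]; evaluation forms
    separate tangent vectors, so it is the one chosen by [sharp]. *)
Lemma sharp_at m (xi : dual (fib T m)) : sharp pi xi
  = \sum_(x <- xs) (xi (x i0 m) *: x i1 m - xi (x i1 m) *: x i0 m).
Proof.
set v := \sum_(x <- xs) _.
have vP (eta : dual (fib T m)) : eta v = pi_at pi xi eta.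
  rewrite pi_atE /v; elim: xs => [|x s IHs]; first by rewrite !big_nil dual0.
  rewrite !big_cons dualD IHs; congr (_ + _).
  by rewrite -scaleNr dualD !dualZ mulNr.
rewrite /sharp; case: xgetP => [w _ wP|/(_ v)[]//].
by apply: tangentP => f; have := wP (eval_form _ f); rewrite -vP.
Qed.

Lemma sharp_sec xi : sec_map (sharp pi) xi
  = \sum_(x <- xs) (smul (pairing xi (x i0)) (x i1) - smul (pairing xi (x i1)) (x i0)).
Proof.
set s := \sum_(x <- xs) _.
have -> : sec_map (sharp pi) xi = insubd 0 (sec_val s); last by rewrite valKd.
congr (insubd 0 _); apply: functional_extensionality_dep => m.
rewrite sharp_at -[RHS]/(s m) sec_sumE; apply: eq_bigr => x _.
by rewrite -!pairingE.
Qed.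

Lemma pi_formE xi eta : pi_form pi xi eta
  = \sum_(x <- xs) (pairing xi (x i0) * pairing eta (x i1)
                    - pairing xi (x i1) * pairing eta (x i0)).
Proof.
set f := \sum_(x <- xs) _.
have E : (fun m => pi_at pi (xi m) (eta m)) = f.
  apply/funext => m; rewrite pi_atE /f cinf_sum; apply: eq_bigr => x _.
  by rewrite cinfD cinfN !cinfM !pairingE.
have fs : smooth_fun setT (fun m => pi_at pi (xi m) (eta m)).
  by rewrite E; exact: cinf_smooth.
apply: cinfP => m; rewrite /pi_form (to_cinfE fs).
exact: (congr1 (fun h : M -> R^o => h m) E).
Qed.

Lemma pi_form_skew xi eta : pi_form pi eta xi = - pi_form pi xi eta.
Proof.
rewrite !pi_formE -sumrN; apply: eq_bigr => x _.
by rewrite opprB [X in X - _]mulrC [X in _ - X]mulrC.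
Qed.

Lemma sharp_bundle_map : is_bundle_map (A := T') (B := T) (sharp pi).
Proof.
split=> [m a u v|F FF i].
  rewrite !sharp_at scaler_sumr -big_split; apply: eq_bigr => x _.
  have E w : (a *: u + v : dual (fib T m)) w
      = a * (u : dual (fib T m)) w + (v : dual (fib T m)) w by [].
  rewrite !E /= scalerBr !scalerDl !scalerA.
  by rewrite opprD addrACA.
have oF : open (fdom F) := open_fdom F.
have [_ _ /(_ F FF i) Fs] := @dual_vector_bundle _ _ _ phi.
apply: act_smooth_section => // f.
(* The frame covectors live on [fdom F] and are not global sections, so [sharp_sec] does not apply
   and the expansion of [sharp_at] is checked term by term. *)
have xsm (x : 'I_2 -> sec T) j k : smooth_fun (fdom F) (fun p =>
    (fvec F i p : dual (fib T p)) (x j p) * act (x k) f p).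
  apply: smooth_funM; [exact: oF| |exact: cinf_smooth].
  apply: smooth_section_pairing => //; move=> G GG.
  have [a [as_ aE]] := sec_smooth (x j) GG; exists a; split.
    by move=> l; apply: smooth_funS (as_ l) => q [].
  by move=> p _; exact: aE.
apply: (@smooth_fun_eq _ _ _ _ (fun p => \sum_(x <- xs)
  ((fvec F i p : dual (fib T p)) (x i0 p) * act (x i1) f p
   - (fvec F i p : dual (fib T p)) (x i1 p) * act (x i0) f p))) => //.
  move=> p Fp; rewrite sharp_at tan_sumE; apply: eq_bigr => x _.
  by rewrite !actE.
apply: smooth_fun_sum => // x.
apply: (@smooth_fun_eq _ _ _ _ ((fun p => (fvec F i p : dual (fib T p)) (x i0 p) * act (x i1) f p)
  \+ (fun=> -1) \* (fun p => (fvec F i p : dual (fib T p)) (x i1 p) * act (x i0) f p))) => //.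
  by move=> p _ /=; rewrite mulN1r.
apply: smooth_funD => //.
by apply: smooth_funM => //; exact: smooth_fun_cst.
Qed.

Lemma pairing_sharp xi eta : pairing eta (sec_map (sharp pi) xi) = pi_form pi xi eta.
Proof.
rewrite sharp_sec pi_formE; elim: xs => [|x s IHs].
  rewrite !big_nil; apply: cinfP => m; rewrite pairingE.
  exact: (dual0 (eta m : dual (fib T m))).
by rewrite !big_cons pairing_addr IHs pairing_addr pairing_oppr !pairing_smulr.
Qed.

End BivectorField.

(** * The Schouten bracket on differentials and the twisted Jacobi identity *)

Section HomSchouten.
Context {R : realType} {n : nat} {M : manifold R n} (phi : diffeo M).
Local Notation T := (pull_tangent phi).
Local Notation T' := (dual_bundle T).
Local Notation phis := (pull_fun phi).
Local Notation phisV := (pull_fun (dbwd phi)).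
Local Notation i0 := (ord0 : 'I_2).
Local Notation i1 := (lift ord0 ord0 : 'I_2).
Implicit Types (f g h : cinf M) (x y : 'I_2 -> sec T) (m : M) (xi eta : sec T').

(* [\det (v_a (u_b))] for [u_b = [x_i, y_j], Ad x_i', Ad y_j'] and [v_a] the
   differential of [phis f_a], up to an application of [phis]. *)
Definition schouten_term x y (i j i' j' : 'I_2) f g h : cinf M :=
  let X f := act (x i') f in
  let Y f := act (y j') f in
  let B f := act (x i) (phisV (act (y j) f)) - act (y j) (phisV (act (x i) f)) in
  B f * (X g * Y h - Y g * X h) - X f * (B g * Y h - Y g * B h)
  + Y f * (B g * X h - X g * B h).

Definition schouten_form x y f g h : cinf M :=
  schouten_term x y i0 i0 i1 i1 f g h - schouten_term x y i0 i1 i1 i0 f g h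
  - schouten_term x y i1 i0 i0 i1 f g h + schouten_term x y i1 i1 i0 i0 f g h.

(** Evaluation on the differentials of [phis f], [phis g], [phis h] cancels the innermost [phisV] in
    [Ad] and [bracket], so that one outer [phis] can be pulled out of the whole expression. *)
Lemma schouten_wedgeE x y f g h m :
  (schouten_wedge x y m : ext 3 (fib T m)) (fun a => eval_form (phi m)
     (phis (if a == ord0 then f else if a == lift ord0 ord0 then g else h)))
  = phis (schouten_form x y f g h) m.
Proof.
set zeta := fun a : 'I_3 => _.
pose V i j (a : 'I_3) : sec T := match unlift ord0 a with
    | None => bracket (x i) (y j)
    | Some b => match fintype.split (b : 'I_(1 + 1)) with
                | inl b1 => Ad (x (@lift 2 i b1))
                | inr b2 => Ad (y (@lift 2 j b2))
                end
    end.
(* In bidegree (2, 2) each factor leaves one vector over. The slots after the bracket hold [Ad] of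
   the leftover [x], then of the leftover [y], and [lift i ord0] is the index other than [i]. *)
have split0 : fintype.split (ord0 : 'I_(1 + 1)) = inl ord0.
  by apply: (can_inj (@unsplitK 1 1)); rewrite splitK; exact: val_inj.
have split1 : fintype.split (lift ord0 ord0 : 'I_(1 + 1)) = inr ord0.
  by apply: (can_inj (@unsplitK 1 1)); rewrite splitK; exact: val_inj.
have V0 i j : V i j ord0 = bracket (x i) (y j) by rewrite /V unlift_none.
have V1 i j : V i j (lift ord0 ord0) = Ad (x (@lift 2 i ord0)).
  by rewrite /V liftK [fintype.split _]split0.
have V2 i j : V i j (lift ord0 (lift ord0 ord0)) = Ad (y (@lift 2 j ord0)).
  by rewrite /V liftK [fintype.split _]split1.
have zetaE a (u : sec T) : zeta a (u m) = act u
    (phis (if a == ord0 then f else if a == lift ord0 ord0 then g else h)) m.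
  by rewrite actE.
have -> : (schouten_wedge x y m : ext 3 (fib T m)) zeta
    = \sum_(i < 2) \sum_(j < 2) (-1) ^+ (i + j) * \det (\matrix_(a, b) zeta a (V i j b m)).
  rewrite /schouten_wedge ext_sumE; apply: eq_bigr => i _.
  by rewrite ext_sumE; apply: eq_bigr => j _.
have brE i j f' : act (bracket (x i) (y j)) (phis f') = phis (act (x i) (phisV (act (y j) f'))
    - act (y j) (phisV (act (x i) f'))).
  by rewrite act_bracket !phisK pull_funD pull_funN.
have AdE (z : sec T) f' : act (Ad z) (phis f') = phis (act z f') by rewrite act_Ad phisK.
have detE i j : \det (\matrix_(a, b) zeta a (V i j b m))
    = phis (schouten_term x y i j (@lift 2 i ord0) (@lift 2 j ord0) f g h) m.
  rewrite det_matrix3 !V0 !V1 !V2 !zetaE /= !brE !AdE /schouten_term.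
  repeat match goal with
  | |- context [@act ?R ?n ?M ?p ?x ?f] => generalize (@act R n M p x f); intro
  end.
  by rewrite !pull_funE !(cinfD, cinfN, cinfM).
pose w (i j : 'I_2) : R := phis (schouten_term x y i j (@lift 2 i ord0) (@lift 2 j ord0) f g h) m.
transitivity (\sum_(i < 2) \sum_(j < 2) (-1) ^+ (i + j) * w i j).
  by apply: eq_bigr => i _; apply: eq_bigr => j _; rewrite detE.
have -> : \sum_(i < 2) \sum_(j < 2) (-1) ^+ (i + j) * w i j
    = w i0 i0 - w i0 i1 - w i1 i0 + w i1 i1.
  clearbody w; rewrite !big_ord_recl !big_ord0 /= /bump /= expr0 expr1 sqrrN expr1n.
  by rewrite !addr0 !mul1r !mulN1r addrA.
have l10 : @lift 2 (lift ord0 ord0) ord0 = ord0 by exact: val_inj.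
rewrite /w !l10 /schouten_form.
repeat match goal with
| |- context [schouten_term ?x ?y ?i ?j ?k ?l ?f ?g ?h] =>
  generalize (schouten_term x y i j k l f g h); intro
end.
by rewrite !pull_funE !(cinfD, cinfN).
Qed.

Let biv x f g : cinf M := act (x i0) f * act (x i1) g - act (x i1) f * act (x i0) g.

(** The contribution of one pair of wedges to [J f (phisV (J g h))], with [x] taken from the outer
    bivector and [y] from the inner one. *)
Let nested x y f g h : cinf M := biv x f (phisV (biv y g h)).

(** The terms with [x] outside give [x] applied after [y], those with [y] outside the reverse;
    together they form the commutators [B] of [schouten_term]. *)
Lemma schouten_form_jacobiator x y f g h :
  nested x y f g h + nested x y g h f + nested x y h f g
  + (nested y x f g h + nested y x g h f + nested y x h f g) = schouten_form x y f g h.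
Proof.
rewrite /nested /biv /schouten_form /schouten_term.
rewrite !(pull_funD, pull_funN, pull_funM, actD, actN, actM, phisVK).
cinf_ring.
Qed.

Section HomPoisson.
Variable pi : sec (ext_bundle 2 T).

Let J f g := pi_form pi (dif phi f) (dif phi g).

Let J_biv xs f g : sec_val pi = \sum_(x <- xs) wedge_sec x ->
  J f g = \sum_(x <- xs) biv x f g.
Proof.
by move=> E; rewrite /J (pi_formE E); apply: eq_bigr => x _; rewrite !pairing_dif.
Qed.

(** Invariance lets the left side be computed with the decomposition moved by [Ad], and pairing
    [Ad_dag xi] with [Ad x] is [phis] of the original pairing. *)
Lemma pi_form_Ad_dag xi eta : is_Ad pi pi ->
  pi_form pi (Ad_dag xi) (Ad_dag eta) = phis (pi_form pi xi eta).
Proof.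
move=> [xs [E E']]; have {}E' : sec_val pi
    = \sum_(x <- [seq (@Ad _ _ _ phi) \o x | x <- xs]) wedge_sec x.
  by rewrite big_map.
rewrite (pi_formE E') (pi_formE E) big_map pull_fun_sum; apply: eq_bigr => x _ /=.
by rewrite !pairing_Ad_dag_Ad pull_funD pull_funN !pull_funM.
Qed.

Let J_nested xs ys f g h :
  sec_val pi = \sum_(x <- xs) wedge_sec x -> sec_val pi = \sum_(y <- ys) wedge_sec y ->
  J f (phisV (J g h)) = \sum_(x <- xs) \sum_(y <- ys) nested x y f g h.
Proof.
move=> Ex Ey; rewrite (J_biv _ _ Ex); apply: eq_bigr => x _.
rewrite (J_biv _ _ Ey) pull_fun_sum /biv !act_sum !mulr_sumr -sumrB.
by [].
Qed.

(* Decomposing the outer and the inner bivector in either order yields the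
   Jacobiator twice, and the two expressions add up to the Schouten bracket. *)
Lemma hom_jacobi f g h : is_hom_poisson pi ->
  J (phis f) (J g h) + J (phis g) (J h f) + J (phis h) (J f g) = 0.
Proof.
move=> [[xs [ys [Ex Ey S0]]] piAd].
(* Invariance of [pi] takes [phis] out of the first argument at the price of [phisV] in the second,
   which is the form of [nested]. *)
have JA f1 f2 : J (phis f1) f2 = phis (J f1 (phisV f2)).
  by rewrite /J -(pi_form_Ad_dag _ _ piAd) !Ad_dag_dif phisVK.
rewrite !JA -!pull_funD; set K := _ + _ + _; suff -> : K = 0 by rewrite pull_fun0.
have K1 : K = \sum_(x <- xs) \sum_(y <- ys)
    (nested x y f g h + nested x y g h f + nested x y h f g).
  rewrite /K !(J_nested _ _ _ Ex Ey) -!big_split; apply: eq_bigr => x _.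
  by rewrite -!big_split.
have K2 : K = \sum_(x <- xs) \sum_(y <- ys)
    (nested y x f g h + nested y x g h f + nested y x h f g).
  rewrite exchange_big /K !(J_nested _ _ _ Ey Ex) -!big_split; apply: eq_bigr => x _.
  by rewrite -!big_split.
have KS : K + K = \sum_(x <- xs) \sum_(y <- ys) schouten_form x y f g h.
  rewrite {1}K1 K2 -big_split; apply: eq_bigr => x _; rewrite -big_split.
  by apply: eq_bigr => y _; exact: schouten_form_jacobiator.
(* [schouten_wedgeE] computes [phis] of the form; the injectivity of [phis] removes it
   afterwards. *)
have : phis (K + K) = 0.
  apply: cinfP => m; rewrite KS pull_fun_sum cinf_sum.
  pose zeta (a : 'I_3) := eval_form (phi m)
     (phis (if a == ord0 then f else if a == lift ord0 ord0 then g else h)).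
  have := congr1 (fun P : rawsec (ext_bundle 3 T) => (P m : ext 3 (fib T m)) zeta) S0.
  rewrite ext_sumE => S0'; transitivity (0 : R); last by [].
  rewrite [RHS](_ : 0 = (sec_val (0 : sec (ext_bundle 3 T)) m : ext 3 (fib T m)) zeta)//.
  rewrite [RHS]S0'; apply: eq_bigr => x _.
  rewrite ext_sumE pull_fun_sum cinf_sum; apply: eq_bigr => y _.
  by rewrite -schouten_wedgeE.
move=> /(congr1 phisV); rewrite phisK pull_fun0 -mulr2n -scaler_nat => /eqP.
by rewrite scaler_eq0 pnatr_eq0 /= => /eqP.
Qed.

End HomPoisson.

End HomSchouten.

(* Here [A] stands for smooth functions with [s] the pullback by the
   diffeomorphism, [V] and [W] for sections of the tangent and cotangent
   pullback bundles.  Keeping them abstract prevents [ring] and [rewrite] from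
   unfolding smooth sections when they compare terms. *)
Section CotangentBracket.
Variables (A : comPzRingType) (V W : zmodType).
Variables (s sV : A -> A) (scV : A -> V -> V) (scW : A -> W -> W).
Variables (act : V -> A -> A) (pr : W -> V -> A) (Ad AdV : V -> V) (bracket : V -> V -> V).
Variables (Adag : W -> W) (dif : A -> W) (lie : V -> W -> W) (S : W -> V) (P : W -> W -> A).
Implicit Types (f g h : A) (x y z : V) (xi eta zeta : W).

Hypothesis sK : cancel s sV.
Hypothesis sVK : cancel sV s.
Hypothesis sD : forall f g, s (f + g) = s f + s g.
Hypothesis sM : forall f g, s (f * g) = s f * s g.
Hypothesis actD : forall x f g, act x (f + g) = act x f + act x g.
Hypothesis actM : forall x f g, act x (f * g) = act x f * s g + s f * act x g.
Hypothesis act_addl : forall x y f, act (x + y) f = act x f + act y f.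
Hypothesis act_scl : forall g x f, act (scV g x) f = g * act x f.
Hypothesis act_inj : forall x y, (forall f, act x f = act y f) -> x = y.
Hypothesis pr_addl : forall xi eta x, pr (xi + eta) x = pr xi x + pr eta x.
Hypothesis pr_addr : forall xi x y, pr xi (x + y) = pr xi x + pr xi y.
Hypothesis pr_scl : forall f xi x, pr (scW f xi) x = f * pr xi x.
Hypothesis pr_scr : forall f xi x, pr xi (scV f x) = f * pr xi x.
Hypothesis pr_inj : forall xi eta, (forall x, pr xi x = pr eta x) -> xi = eta.
Hypothesis act_Ad : forall x f, act (Ad x) f = s (act x (sV f)).
Hypothesis act_AdV : forall x f, act (AdV x) f = sV (act x (s f)).
Hypothesis act_bracket : forall x y f, act (bracket x y) f
  = s (act x (sV (act y (sV f)))) - s (act y (sV (act x (sV f)))).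
Hypothesis pr_Adag : forall xi x, pr (Adag xi) x = s (pr xi (AdV x)).
Hypothesis pr_dif : forall f x, pr (dif f) x = act x f.
Hypothesis pr_lie : forall x eta y, pr (lie x eta) y
  = act (Ad x) (pr eta (AdV y)) - pr (Adag eta) (bracket x (AdV y)).
Hypothesis pr_S : forall xi eta, pr eta (S xi) = P xi eta.
Hypothesis P_skew : forall xi eta, P eta xi = - P xi eta.
Hypothesis P_Adag : forall xi eta, P (Adag xi) (Adag eta) = s (P xi eta).
Hypothesis P_jacobi : forall f g h,
  P (dif (s f)) (dif (P (dif g) (dif h))) + P (dif (s g)) (dif (P (dif h) (dif f)))
  + P (dif (s h)) (dif (P (dif f) (dif g))) = 0.
(** The exponent [k] records the twist of the tensoriality: it is 1 for the anchor defect and 2 for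
    the Jacobiator. *)
Hypothesis dif_generates : forall k (H : W -> A),
  (forall xi eta, H (xi + eta) = H xi + H eta) ->
  (forall f xi, H (scW f xi) = iter k s f * H xi) ->
  (forall f, H (dif f) = 0) -> forall xi, H xi = 0.

Definition cotangent_bracket xi eta := lie (S xi) eta - lie (S eta) xi - dif (P xi eta).
Local Notation br := cotangent_bracket.
Local Notation a xi f := (act (S xi) f).

Let additive_opp (B C : zmodType) (F : B -> C) :
  (forall u v, F (u + v) = F u + F v) -> forall u, F (- u) = - F u.
Proof.
move=> FD u; have F0 : F 0 = 0 by apply: (addrI (F 0)); rewrite -FD !addr0.
by apply: (addrI (F u)); rewrite -FD !subrr F0.
Qed.

Let sN f : s (- f) = - s f. Proof. exact: additive_opp. Qed.
Let sVD f g : sV (f + g) = sV f + sV g.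
Proof. by apply: (can_inj sK); rewrite sD !sVK. Qed.
Let sVM f g : sV (f * g) = sV f * sV g.
Proof. by apply: (can_inj sK); rewrite sM !sVK. Qed.
Let sVN f : sV (- f) = - sV f. Proof. exact: additive_opp. Qed.
Let actN x f : act x (- f) = - act x f. Proof. exact: additive_opp. Qed.
Let act_oppl x f : act (- x) f = - act x f.
Proof. by apply: (additive_opp (F := act^~ f)). Qed.
Let pr_oppl xi x : pr (- xi) x = - pr xi x.
Proof. by apply: (additive_opp (F := pr^~ x)). Qed.
Let pr_oppr xi x : pr xi (- x) = - pr xi x. Proof. exact: additive_opp. Qed.

Let sE := (sD, sM, sN, sK, sVK, sVD, sVM, sVN).
Let actE := (act_addl, act_oppl, act_scl, actD, actN, actM).
Let prE := (pr_addl, pr_addr, pr_scl, pr_scr, pr_oppl, pr_oppr).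

Let AdVK : cancel AdV Ad.
Proof. by move=> x; apply: act_inj => f; rewrite act_Ad act_AdV !sVK. Qed.

Let AdK : cancel Ad AdV.
Proof. by move=> x; apply: act_inj => f; rewrite act_AdV act_Ad !sK. Qed.

Let AdD x y : Ad (x + y) = Ad x + Ad y.
Proof. by apply: act_inj => f; rewrite !actE !act_Ad !actE sD. Qed.

Let Ad_sc f x : Ad (scV f x) = scV (s f) (Ad x).
Proof. by apply: act_inj => g; rewrite !actE !act_Ad !actE sM. Qed.

Let bracketDl x y z : bracket (x + y) z = bracket x z + bracket y z.
Proof.
by apply: act_inj => f; rewrite !(actE, act_bracket) !(sE, actE); ring.
Qed.

Let bracket_scl f x y : bracket (scV f x) y = scV (s f) (bracket x y) - scV (act (Ad y) f) (Ad x).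
Proof.
apply: act_inj => g; rewrite !(actE, act_bracket, act_Ad) !(sE, actE).
by ring.
Qed.

Let Ad_bracket x y : Ad (bracket x y) = bracket (Ad x) (Ad y).
Proof.
by apply: act_inj => f; rewrite !(act_Ad, act_bracket) !sE.
Qed.

Let lieDr x xi eta : lie x (xi + eta) = lie x xi + lie x eta.
Proof.
by apply: pr_inj => y; rewrite !(prE, pr_lie, pr_Adag) !(actE, sE); ring.
Qed.

Let lieDl x y xi : lie (x + y) xi = lie x xi + lie y xi.
Proof.
by apply: pr_inj => z; rewrite !(prE, pr_lie) AdD bracketDl !(actE, prE); ring.
Qed.

Let lie_scr x f xi : lie x (scW f xi) = scW (s f) (lie x xi) + scW (act (Ad x) f) (Adag xi).
Proof.
by apply: pr_inj => y; rewrite !(prE, pr_lie, pr_Adag) !(actE, sE); ring.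
Qed.

Let lie_scl x f xi : lie (scV f x) xi = scW (s f) (lie x xi) + scW (s (pr xi x)) (dif f).
Proof.
apply: pr_inj => y; rewrite !(prE, pr_lie, pr_dif) Ad_sc bracket_scl !(actE, prE) AdVK.
by rewrite (pr_Adag xi (Ad x)) AdK; ring.
Qed.

Let lie_dif x f : lie x (dif f) = dif (act x f).
Proof.
apply: pr_inj => y; rewrite pr_lie pr_Adag !pr_dif !(act_AdV, act_Ad, act_bracket) !sE.
by ring.
Qed.

Let Adag_dif f : Adag (dif f) = dif (s f).
Proof. by apply: pr_inj => x; rewrite pr_Adag !pr_dif act_AdV sVK. Qed.

Let AdagD xi eta : Adag (xi + eta) = Adag xi + Adag eta.
Proof. by apply: pr_inj => x; rewrite !(prE, pr_Adag) sD. Qed.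

Let Adag_sc f xi : Adag (scW f xi) = scW (s f) (Adag xi).
Proof. by apply: pr_inj => x; rewrite !(prE, pr_Adag) sM. Qed.

Let AdagN xi : Adag (- xi) = - Adag xi. Proof. exact: additive_opp. Qed.

Let Adag_lie x xi : Adag (lie x xi) = lie (Ad x) (Adag xi).
Proof.
apply: pr_inj => y; rewrite pr_Adag !pr_lie sD sN !pr_Adag (act_Ad (Ad x)) sK.
by rewrite -[in AdV (bracket (Ad x) _)](AdVK (AdV y)) -Ad_bracket AdK.
Qed.

Let difD f g : dif (f + g) = dif f + dif g.
Proof. by apply: pr_inj => x; rewrite !(prE, pr_dif) actD. Qed.

Let difN f : dif (- f) = - dif f. Proof. exact: additive_opp. Qed.

Let difM f g : dif (f * g) = scW (s g) (dif f) + scW (s f) (dif g).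
Proof. by apply: pr_inj => x; rewrite !(prE, pr_dif) actM; ring. Qed.

Let P_addr xi eta zeta : P xi (eta + zeta) = P xi eta + P xi zeta.
Proof. by rewrite -!pr_S prE. Qed.

Let P_oppr xi eta : P xi (- eta) = - P xi eta. Proof. exact: additive_opp. Qed.

Let P_scr f xi eta : P xi (scW f eta) = f * P xi eta.
Proof. by rewrite -!pr_S prE. Qed.

Let P_addl xi eta zeta : P (xi + eta) zeta = P xi zeta + P eta zeta.
Proof. by rewrite -[LHS]opprK -P_skew P_addr opprD -!P_skew. Qed.

Let P_scl f xi eta : P (scW f xi) eta = f * P xi eta.
Proof. by rewrite -[LHS]opprK -P_skew P_scr -mulrN -P_skew. Qed.

Let anchorE xi f : a xi f = P xi (dif f). Proof. by rewrite -pr_S pr_dif. Qed.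

Let SD xi eta : S (xi + eta) = S xi + S eta.
Proof. by apply: act_inj => f; rewrite act_addl !anchorE P_addl. Qed.

Let S_sc f xi : S (scW f xi) = scV f (S xi).
Proof. by apply: act_inj => g; rewrite act_scl !anchorE P_scl. Qed.

Let SN xi : S (- xi) = - S xi. Proof. exact: additive_opp. Qed.

(** Tested on [f], whose differential is [Adag (dif (sV f))], this becomes the invariance
    [P_Adag]. *)
Let S_Adag xi : S (Adag xi) = Ad (S xi).
Proof. by apply: act_inj => f; rewrite act_Ad !anchorE -P_Adag Adag_dif sVK. Qed.

Lemma cotangent_bracket_skew xi eta : br xi eta = - br eta xi.
Proof.
apply: pr_inj => x; rewrite /br !(prE, pr_dif) [P eta xi]P_skew actN.
by ring.
Qed.

Lemma cotangent_bracketDr xi eta zeta : br xi (eta + zeta) = br xi eta + br xi zeta.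
Proof.
apply: pr_inj => x; rewrite /br SD lieDr lieDl P_addr difD !prE.
by ring.
Qed.

(** The multiples of [dif f] produced by [lie_scl] and by [difM] cancel, because [P] is skew. *)
Lemma cotangent_bracket_leibniz xi f eta :
  br xi (scW f eta) = scW (s f) (br xi eta) + scW (a (Adag xi) f) (Adag eta).
Proof.
apply: pr_inj => x; rewrite /br S_sc lie_scr lie_scl P_scr difM S_Adag pr_S P_skew.
by rewrite !prE sN; ring.
Qed.

Lemma Adag_cotangent_bracket xi eta : Adag (br xi eta) = br (Adag xi) (Adag eta).
Proof.
by rewrite /br !(AdagD, AdagN) !Adag_lie Adag_dif !S_Adag P_Adag.
Qed.

Lemma cotangent_anchor_Adag xi f : a (Adag xi) (s f) = s (a xi f).
Proof. by rewrite S_Adag act_Ad sK. Qed.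

Let br_dif f g : br (dif f) (dif g) = dif (P (dif f) (dif g)).
Proof.
rewrite /br !lie_dif !anchorE [P (dif g) _]P_skew difN opprK.
by rewrite addrK.
Qed.

Let defect xi eta f := a (br xi eta) (s f)
  - (a (Adag xi) (a eta f) - a (Adag eta) (a xi f)).

Let defect_skew xi eta f : defect eta xi f = - defect xi eta f.
Proof. by rewrite /defect cotangent_bracket_skew SN act_oppl; ring. Qed.

Let defect_addr xi eta zeta f : defect xi (eta + zeta) f = defect xi eta f + defect xi zeta f.
Proof.
rewrite /defect cotangent_bracketDr AdagD !SD !actE.
by ring.
Qed.

(** The Leibniz rule of the bracket and the derivation rule of the anchor both produce
    [a (Adag xi) g * s (a eta f)], once [cotangent_anchor_Adag] is used; the two cancel. *)
Let defect_scr xi g eta f : defect xi (scW g eta) f = s g * defect xi eta f.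
Proof.
rewrite /defect cotangent_bracket_leibniz Adag_sc SD !S_sc !actE !cotangent_anchor_Adag.
by ring.
Qed.

Let defect_dif g h f : defect (dif g) (dif h) f = 0.
Proof.
rewrite /defect br_dif !Adag_dif !anchorE -oppr0 -(P_jacobi f g h) [P (dif (s f)) _]P_skew.
by rewrite [P (dif g) (dif f)]P_skew difN P_oppr; ring.
Qed.

Let defect0 xi eta f : defect xi eta f = 0.
Proof.
move: eta; apply: (@dif_generates 1) => [eta zeta|g eta|g]; first exact: defect_addr.
  exact: defect_scr.
(* Tensoriality is available in the second slot, so skew-symmetry moves the other argument there. *)
rewrite -[LHS]opprK -defect_skew; apply/eqP; rewrite oppr_eq0; apply/eqP.
move: xi; apply: (@dif_generates 1) => [eta zeta|h eta|h]; first exact: defect_addr.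
  exact: defect_scr.
exact: defect_dif.
Qed.

Lemma cotangent_anchor_bracket xi eta f :
  a (br xi eta) (s f) = a (Adag xi) (a eta f) - a (Adag eta) (a xi f).
Proof. by apply/eqP; rewrite -subr_eq0; apply/eqP; exact: defect0. Qed.

Let jac xi eta zeta := br (Adag xi) (br eta zeta) + br (Adag eta) (br zeta xi)
  + br (Adag zeta) (br xi eta).

Let jac_cycle xi eta zeta : jac xi eta zeta = jac eta zeta xi.
Proof. by rewrite /jac -addrA addrC. Qed.

Let brDl xi eta zeta : br (xi + eta) zeta = br xi zeta + br eta zeta.
Proof. by rewrite ![br _ zeta]cotangent_bracket_skew cotangent_bracketDr opprD. Qed.

Let brNr xi eta : br xi (- eta) = - br xi eta.
Proof. by apply: (additive_opp (F := br xi)); exact: cotangent_bracketDr. Qed.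

Let jac_addr xi eta zeta1 zeta2 : jac xi eta (zeta1 + zeta2) = jac xi eta zeta1 + jac xi eta zeta2.
Proof.
rewrite /jac AdagD !(brDl, cotangent_bracketDr); apply: pr_inj => x; rewrite !prE.
by ring.
Qed.

(** The first-order derivatives of [f] cancel in pairs because [Adag] preserves the bracket. The
    remaining multiple of [Adag (Adag zeta)] is the anchor defect of [Adag xi] and [Adag eta], so
    [cotangent_anchor_bracket] removes it. *)
Let jac_scr xi eta f zeta : jac xi eta (scW f zeta) = scW (s (s f)) (jac xi eta zeta).
Proof.
have nested (x y : W) : br (Adag x) (br y (scW f zeta))
    = scW (s (s f)) (br (Adag x) (br y zeta)) + scW (s (a (Adag x) f)) (Adag (br y zeta))
    + (scW (s (a (Adag y) f)) (br (Adag x) (Adag zeta))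
       + scW (a (Adag (Adag x)) (a (Adag y) f)) (Adag (Adag zeta))).
  rewrite (cotangent_bracket_leibniz y) (cotangent_bracketDr _ (scW _ _)).
  by rewrite !(cotangent_bracket_leibniz (Adag x)) cotangent_anchor_Adag.
rewrite /jac Adag_sc [br (scW f zeta) xi]cotangent_bracket_skew brNr !nested.
rewrite [br (scW (s f) _) _]cotangent_bracket_skew (cotangent_bracket_leibniz (br xi eta)).
rewrite !Adag_cotangent_bracket cotangent_anchor_bracket.
rewrite [br zeta xi]cotangent_bracket_skew brNr.
rewrite [br (Adag zeta) (br xi eta)]cotangent_bracket_skew.
apply: pr_inj => x; rewrite !prE.
by ring.
Qed.

Let jac_dif f g h : jac (dif f) (dif g) (dif h) = 0.
Proof.
have dif0 : dif 0 = 0 by apply: (addrI (dif 0)); rewrite -difD !addr0.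
by rewrite /jac !Adag_dif !br_dif -!difD P_jacobi dif0.
Qed.

(** Pairing with [x] makes the Jacobiator function-valued, as [dif_generates] requires, and its
    cyclic symmetry brings each argument in turn into the last slot, where it is tensorial. *)
Lemma cotangent_bracket_jacobi xi eta zeta :
  br (Adag xi) (br eta zeta) + br (Adag eta) (br zeta xi) + br (Adag zeta) (br xi eta) = 0.
Proof.
rewrite -/(jac xi eta zeta); apply: pr_inj => x.
have pr0 : pr 0 x = 0 by apply: (addrI (pr 0 x)); rewrite -pr_addl !addr0.
pose H xi eta zeta := pr (jac xi eta zeta) x.
have HD xi' eta' zeta1 zeta2 : H xi' eta' (zeta1 + zeta2) = H xi' eta' zeta1 + H xi' eta' zeta2.
  by rewrite /H jac_addr pr_addl.
have HM xi' eta' f zeta' : H xi' eta' (scW f zeta') = iter 2 s f * H xi' eta' zeta'.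
  by rewrite /H jac_scr pr_scl.
have Hc xi' eta' zeta' : H xi' eta' zeta' = H eta' zeta' xi' by rewrite /H jac_cycle.
rewrite pr0 -/(H xi eta zeta); move: zeta; apply: (dif_generates (HD xi eta) (HM xi eta)) => f.
rewrite -Hc; move: eta; apply: (dif_generates (HD _ xi) (HM _ xi)) => g.
rewrite -Hc; move: xi; apply: (dif_generates (HD _ _) (HM _ _)) => h.
by rewrite /H jac_dif pr0.
Qed.

Lemma cotangent_bracket_identities :
  [/\ forall xi eta, br xi eta = - br eta xi,
      forall xi eta zeta, br xi (eta + zeta) = br xi eta + br xi zeta,
      forall xi eta, Adag (br xi eta) = br (Adag xi) (Adag eta)
    & forall xi eta zeta, br (Adag xi) (br eta zeta) + br (Adag eta) (br zeta xi)
        + br (Adag zeta) (br xi eta) = 0] /\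
  [/\ forall xi f eta, br xi (scW f eta)
        = scW (s f) (br xi eta) + scW (a (Adag xi) f) (Adag eta),
      forall xi f, a (Adag xi) (s f) = s (a xi f)
    & forall xi eta f, a (br xi eta) (s f)
        = a (Adag xi) (a eta f) - a (Adag eta) (a xi f)].
Proof.
split; split.
- exact: cotangent_bracket_skew.
- exact: cotangent_bracketDr.
- exact: Adag_cotangent_bracket.
- exact: cotangent_bracket_jacobi.
- exact: cotangent_bracket_leibniz.
- exact: cotangent_anchor_Adag.
- exact: cotangent_anchor_bracket.
Qed.

End CotangentBracket.

(** * Specialization of the abstract identities to smooth sections *)

Lemma dif_generates (R : realType) (n : nat) (M : manifold R n) (phi : diffeo M) k
    (H : sec (dual_bundle (pull_tangent phi)) -> cinf M) :
  (forall xi eta, H (xi + eta) = H xi + H eta) ->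
  (forall f xi, H (smul f xi) = iter k (pull_fun phi) f * H xi) ->
  (forall f, H (dif phi f) = 0) -> forall xi, H xi = 0.
Proof.
move=> HD HM Hdif xi; apply: cinfP => m.
(* The coefficient of [H xi] at [m] is the value of [chi] at the [k]-th iterate of [m], so the bump
   function and the local generators are taken there. *)
have iterE f : iter k (pull_fun phi) f m = f (iter k phi m).
  elim: k m {HM} => // k IHk m; by rewrite iterS pull_funE IHk iterSr.
have [chi [X [chi1 /(_ xi)[g gE]]]] := form_local_generators phi (iter k phi m).
have := congr1 (fun u : cinf M => u m) (congr1 H gE); rewrite HM cinfM iterE chi1 mul1r => ->.
have -> : H (\sum_i smul (g i) (dif phi (X i))) = 0; last by [].
have H0 : H 0 = 0 by apply: (addrI (H 0)); rewrite -HD !addr0.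
apply: (big_ind (fun u => H u = 0)) => // [u v Hu Hv|i _].
  by rewrite HD Hu Hv addr0.
by rewrite HM Hdif mulr0.
Qed.

Lemma poisson_bracket_identities (R : realType) (n : nat) (M : manifold R n) (phi : diffeo M)
    (pi : sec (ext_bundle 2 (pull_tangent phi))) : is_hom_poisson pi ->
  let phis := pull_fun phi in
  let br := poisson_bracket pi in
  let a xi := act (sec_map (sharp pi) xi) in
  [/\ forall xi eta, br xi eta = - br eta xi,
      forall xi eta zeta, br xi (eta + zeta) = br xi eta + br xi zeta,
      forall xi eta, Ad_dag (br xi eta) = br (Ad_dag xi) (Ad_dag eta)
    & forall xi eta zeta, br (Ad_dag xi) (br eta zeta) + br (Ad_dag eta) (br zeta xi)
        + br (Ad_dag zeta) (br xi eta) = 0] /\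
  [/\ forall xi f eta, br xi (smul f eta)
        = smul (phis f) (br xi eta) + smul (a (Ad_dag xi) f) (Ad_dag eta),
      forall xi f, a (Ad_dag xi) (phis f) = phis (a xi f)
    & forall xi eta f, a (br xi eta) (phis f)
        = a (Ad_dag xi) (a eta f) - a (Ad_dag eta) (a xi f)].
Proof.
move=> poisson phis br a; have [_ piAd] := poisson; have [xs [E _]] := piAd.
apply: (@cotangent_bracket_identities (cinf M) (sec (pull_tangent phi))
  (sec (dual_bundle (pull_tangent phi))) phis (pull_fun (dbwd phi)) (@smul _ _ _ _) (@smul _ _ _ _)
  (@act _ _ _ phi) (@pairing _ _ _ phi) (@Ad _ _ _ phi) (@AdV _ _ _ phi) (@bracket _ _ _ phi)
  (@Ad_dag _ _ _ phi) (@dif _ _ _ phi) (@lie _ _ _ phi) (sec_map (sharp pi)) (pi_form pi)).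
- exact: phisK.
- exact: phisVK.
- exact: pull_funD.
- exact: pull_funM.
- exact: actD.
- exact: actM.
- exact: act_addl.
- exact: act_smul.
- exact: act_inj.
- exact: pairing_addl.
- exact: pairing_addr.
- exact: pairing_smull.
- by move=> f xi x; exact: pairing_smulr.
- exact: pairing_inj.
- exact: act_Ad.
- exact: act_AdV.
- exact: act_bracket.
- exact: pairing_Ad_dag.
- exact: pairing_dif.
- exact: pairing_lie.
- exact: pairing_sharp E.
- exact: pi_form_skew E.
- by move=> xi eta; exact: pi_form_Ad_dag.
- by move=> f g h; exact: hom_jacobi.
- exact: dif_generates.
Qed.

Theorem theorem3p29 (R : realType) (n : nat) (M : manifold R n)
    (phi : diffeo M) (pi : sec (ext_bundle 2 (pull_tangent phi))) :
  is_hom_poisson pi ->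
  @is_hom_lie_algebroid R n M phi (dual_bundle (pull_tangent phi))
    (@Ad_dag R n M phi) (poisson_bracket pi) (sharp pi).
Proof.
move=> poisson; have [_ [xs [E _]]] := poisson.
have [[brC brD brA brJ] [brM aA abr]] := poisson_bracket_identities poisson.
have cstE (f : cinf M) (c : R) : c *: f = (c *: (1 : cinf M)) * f by exact: cinf_scaleE.
have scaleE (c : R) (xi : sec (dual_bundle (pull_tangent phi))) :
    c *: xi = smul (c *: (1 : cinf M)) xi.
  by apply: pairing_inj => x; rewrite pairing_scalel pairing_smull -cstE.
have act_cst (c : R) (x : sec (pull_tangent phi)) : act x (c *: (1 : cinf M)) = 0.
  by apply: cinfP => m; rewrite actE tangent_cst.
have pull_cst (c : R) : pull_fun phi (c *: (1 : cinf M)) = c *: (1 : cinf M).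
  by apply: cinfP => m; rewrite pull_funE.
(* Real homogeneity is the Leibniz rule for a constant function, which the anchor annihilates and
   the pullback fixes. *)
have brZ xi (c : R) eta : poisson_bracket pi xi (c *: eta) = c *: poisson_bracket pi xi eta.
  rewrite scaleE brM act_cst pull_cst -scaleE; apply: pairing_inj => x.
  by rewrite pairing_addl pairing_smull mul0r addr0.
split.
- split; [exact: dual_vector_bundle|exact: Ad_dag_linear|exact: Ad_dag_smul].
- split=> //; last exact: Ad_dag_linear.
  split=> [xi c eta zeta|eta c xi zeta]; first by rewrite brD brZ.
  by rewrite ![poisson_bracket pi _ eta]brC brD brZ opprD scalerN.
- exact: sharp_bundle_map E.
- by move=> xi eta f; exact: brM.
- split=> //; first by move=> c f g; exact: pull_funL.
  split=> [xi c f g|f c xi eta]; first exact: actL.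
  (* Skew-symmetry of [pi] moves [sharp] from [xi'] to [dif phi f], which reduces linearity in [xi']
     to that of the pairing. *)
  have actS xi' : act (sec_map (sharp pi) xi') f = - pairing xi' (sec_map (sharp pi) (dif phi f)).
    by rewrite -pairing_dif !(pairing_sharp E) (pi_form_skew E).
  by rewrite !actS pairing_addl pairing_scalel opprD scalerN.
Qed.
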